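(* For any real $\lambda>\nu\ge0$, $$\left\lfloor\frac{1}{\pi}\max\left\{\underline{\theta}_\nu(\lambda),-\frac{\pi}{2}\right\}+\frac12\right\rfloor\le\mathcal{N}_{J_\nu}(\lambda)\le\left\lfloor\frac1\pi\widetilde{\theta}_\nu(\lambda)+\frac12\right\rfloor.$$
   Context: $\lfloor\cdot\rfloor$ denotes the integer part (floor). $J_\nu$ is the standard Bessel function of the first kind of order $\nu\ge0$, $j_{\nu,k}$ ($k\in\mathbb{N}=\{1,2,\dots\}$) is its $k$th positive zero in increasing order, and $\mathcal{N}_{J_\nu}(\lambda):=\#\{k\in\mathbb{N}:j_{\nu,k}\le\lambda\}$. For $x>\nu\ge0$ define $$\widetilde{\theta}_\nu(x):=\sqrt{x^2-\nu^2}-\nu\arccos\frac{\nu}{x}-\frac{\pi}{4},\qquad \underline{\theta}_\nu(x):=\widetilde{\theta}_\nu(x)-\frac{3x^2+2\nu^2}{24(x^2-\nu^2)^{3/2}}.$$ *)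

(* Defs.v *)
From Stdlib Require Import Reals Factorial List.
From Coquelicot Require Import Coquelicot.

Open Scope R_scope.

(* Euler's integral, convergent for s > 0. *)
Definition Gamma (s : R) : R :=
  RInt_gen (fun t => Rpower t (s - 1) * exp (- t))
    (at_right 0) (Rbar_locally p_infty).

(* The series for J_nu(x); meaningful only for x > 0, since [Rpower] is. *)
Definition BesselJ (nu x : R) : R :=
  Series (fun m : nat =>
    (-1) ^ m / (INR (fact m) * Gamma (INR m + nu + 1))
    * Rpower (x / 2) (2 * INR m + nu)).

Definition has_card {T : Type} (P : T -> Prop) (n : nat) : Prop :=
  exists l : list T, NoDup l /\ (forall x, In x l <-> P x) /\ length l = n.

(* x = j_{nu,k}: x is a positive zero of J_nu and exactly k positive zeros are
   <= x, x included; in particular k >= 1. *)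
Definition is_bessel_zero (nu : R) (k : nat) (x : R) : Prop :=
  0 < x /\ BesselJ nu x = 0 /\
  has_card (fun y => 0 < y <= x /\ BesselJ nu y = 0) k.

(* N = #{k >= 1 : j_{nu,k} <= lambda}; in particular this set is finite. *)
Definition is_bessel_count (nu lambda : R) (N : nat) : Prop :=
  has_card (fun k : nat => exists x, is_bessel_zero nu k x /\ x <= lambda) N.

Definition theta_tilde (nu x : R) : R :=
  sqrt (x ^ 2 - nu ^ 2) - nu * acos (nu / x) - PI / 4.

Definition theta_under (nu x : R) : R :=
  theta_tilde nu x
  - (3 * x ^ 2 + 2 * nu ^ 2) / (24 * Rpower (x ^ 2 - nu ^ 2) (3 / 2)).

(* Main.v *)
Require Import Defs.
From Stdlib Require Import Reals ZArith Lra Lia List FinFun Factorial ClassicalEpsilon.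
From Coquelicot Require Import Coquelicot.
Open Scope R_scope.

(** The [k]-th positive zero [z_k] of [J_nu] is shown to satisfy
    [theta_under nu z_k <= PI k - PI / 2 <= theta_tilde nu z_k]; since both
    functions increase beyond [nu], counting the [k] with [z_k <= lambda] gives
    the two floors.

    Up to an additive constant the inequalities come from Sturm comparison. In
    the variable [log x] Bessel's equation is [D (D y) = - (x ^ 2 - nu ^ 2) y],
    with [D = x d/dx]. For any increasing phase [psi] the functions
    [sin (psi - c) / sqrt (D psi)] solve a similar equation with an explicit
    potential. For the WKB phase [psi = theta_tilde] that potential is smaller
    than [x ^ 2 - nu ^ 2] ([theta_tilde_slower]); for [theta_under], which adds the
    first-order correction of the WKB phase, it is larger ([theta_under_faster]).
    Hence from one zero of [J_nu] to the next [theta_tilde] grows by at most [PI]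
    and [theta_under] by at least [PI], and as the two phases merge at infinity,
    there is a constant [c_nu] with
    [theta_under nu z_k <= PI k + c_nu <= theta_tilde nu z_k] for all [k]
    ([phase_constant_exists]).

    The constant is computed without any asymptotic analysis of the power series,
    from the behaviour of [c_nu] as a function of [nu].
    - [c_(nu + 1) = c_nu] ([phase_constant_succ]): the zeros of [J_nu] and
      [J_(nu + 1)] interlace, and the rotation of the vector [(J_nu, J_(nu + 1))],
      of speed [1 + O(1 / x)], shows that they do so asymptotically at
      distance [PI / 2].
    - [c_nu <= c_mu] for [nu < mu] ([phase_constant_monotone]): zeros increase
      with the order, and after replacing [nu], [mu] by [nu + n], [mu + n] with [n]
      large, evaluating the inequalities slightly above the turning points,
      where the phases of both orders almost coincide, gives the claim.
    So [c_nu] is nondecreasing and has period [1]: it is constant. For [nu = 1 / 2]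
    the zeros are those of the sine, and [c_(1/2) = - PI / 2]. *)

(** * Calculus *)

Lemma is_derive_value (f : R -> R) (x l l' : R) :
  is_derive f x l -> l = l' -> is_derive f x l'.
Proof. intros H <-; exact H. Qed.

Lemma derive_continuous (f : R -> R) (x l : R) : is_derive f x l -> continuous f x.
Proof. intro H. apply (ex_derive_continuous f). now exists l. Qed.

Lemma is_derive_product (f g : R -> R) (x a b : R) :
  is_derive f x a -> is_derive g x b ->
  is_derive (fun t => f t * g t) x (a * g x + f x * b).
Proof.
  intros Hf Hg. apply (is_derive_mult f g x a b Hf Hg). intros; apply Rmult_comm.
Qed.

Lemma is_derive_difference (f g : R -> R) (x a b : R) :
  is_derive f x a -> is_derive g x b -> is_derive (fun t => f t - g t) x (a - b).
Proof. exact (is_derive_minus f g x a b). Qed.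

Lemma is_derive_sum (f g : R -> R) (x a b : R) :
  is_derive f x a -> is_derive g x b -> is_derive (fun t => f t + g t) x (a + b).
Proof. exact (is_derive_plus f g x a b). Qed.

Lemma is_derive_compose (f g : R -> R) (x a b : R) :
  is_derive f (g x) a -> is_derive g x b -> is_derive (fun t => f (g t)) x (b * a).
Proof. exact (is_derive_comp f g x a b). Qed.

Lemma is_derive_square (f : R -> R) (x a : R) :
  is_derive f x a -> is_derive (fun t => f t ^ 2) x (2 * a * f x).
Proof.
  intro Hf. eapply is_derive_value; [apply (is_derive_pow f 2 x a Hf) | simpl; ring].
Qed.

Lemma mean_value (f df : R -> R) (a b : R) : a < b ->
  (forall x, a <= x <= b -> is_derive f x (df x)) ->
  exists x, a < x < b /\ f b - f a = df x * (b - a).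
Proof.
  intros Hab Hd.
  destruct (MVT_cor2 f df a b Hab) as [x [E Hx]].
  - intros c Hc. now apply is_derive_Reals, Hd.
  - exists x. split; [exact Hx | exact E].
Qed.

Lemma increasing_of_derive (f df : R -> R) (a b : R) : a <= b ->
  (forall x, a <= x <= b -> is_derive f x (df x)) ->
  (forall x, a < x < b -> 0 <= df x) -> f a <= f b.
Proof.
  intros [Hab | <-] Hd Hp; [| lra].
  destruct (mean_value f df a b Hab Hd) as [x [Hx E]].
  specialize (Hp x Hx). nra.
Qed.

Lemma strictly_increasing_of_derive (f df : R -> R) (a b : R) : a < b ->
  (forall x, a <= x <= b -> is_derive f x (df x)) ->
  (forall x, a < x < b -> 0 < df x) -> f a < f b.
Proof.
  intros Hab Hd Hp.
  destruct (mean_value f df a b Hab Hd) as [x [Hx E]].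
  specialize (Hp x Hx). nra.
Qed.

Lemma is_derive_Rpower (a x : R) : 0 < x ->
  is_derive (fun t => Rpower t a) x (a * Rpower x a / x).
Proof.
  intro Hx. eapply is_derive_value.
  - apply is_derive_Reals, derivable_pt_lim_power, Hx.
  - unfold Rminus. rewrite Rpower_plus, Rpower_Ropp, Rpower_1 by exact Hx.
    field. lra.
Qed.

Lemma locally_pos (x : R) : 0 < x -> locally x (fun y => 0 < y).
Proof. intro Hx. now apply (open_gt 0 x). Qed.

Lemma locally_gt (a x : R) : a < x -> locally x (fun y => a < y).
Proof. intro Hx. now apply (open_gt a x). Qed.

Lemma exp_nondecreasing (x y : R) : x <= y -> exp x <= exp y.
Proof.
  intros [H | ->]; [now apply Rlt_le, exp_increasing | apply Rle_refl].
Qed.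

Lemma exp_le_1 (x : R) : x <= 0 -> exp x <= 1.
Proof. intro H. rewrite <- exp_0. now apply exp_nondecreasing. Qed.

(** * Euler's integral *)

Definition gamma_integrand (s t : R) : R := Rpower t (s - 1) * exp (- t).

Lemma gamma_integrand_pos (s t : R) : 0 < gamma_integrand s t.
Proof.
  unfold gamma_integrand, Rpower. apply Rmult_lt_0_compat; apply exp_pos.
Qed.

Lemma gamma_integrand_continuous (s t : R) : 0 < t ->
  continuous (gamma_integrand s) t.
Proof.
  intro Ht. apply (continuous_mult (fun t => Rpower t (s - 1)) (fun t => exp (- t))).
  - eapply derive_continuous. now apply is_derive_Rpower.
  - apply (ex_derive_continuous (fun t => exp (- t))). auto_derive. exact I.
Qed.

Definition gamma_primitive (s x : R) : R := RInt (gamma_integrand s) 1 x.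

Lemma gamma_primitive_1 (s : R) : gamma_primitive s 1 = 0.
Proof. exact (RInt_point 1 (gamma_integrand s)). Qed.

Lemma gamma_primitive_derive (s x : R) : 0 < x ->
  is_derive (gamma_primitive s) x (gamma_integrand s x).
Proof.
  intro Hx. apply (is_derive_RInt (gamma_integrand s) (gamma_primitive s) 1 x).
  - apply (filter_imp (fun y => 0 < y)); [| now apply locally_pos].
    intros y Hy. apply (RInt_correct (gamma_integrand s)), (ex_RInt_continuous (V := R_CompleteNormedModule)).
    intros z [Hz _]. apply gamma_integrand_continuous.
    eapply Rlt_le_trans; [| exact Hz]. apply Rmin_glb_lt; lra.
  - now apply gamma_integrand_continuous.
Qed.

Lemma gamma_primitive_incr (s x y : R) : 0 < x -> x <= y ->
  gamma_primitive s x <= gamma_primitive s y.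
Proof.
  intros Hx Hxy. apply (increasing_of_derive _ (gamma_integrand s)); [exact Hxy | |].
  - intros z Hz. apply gamma_primitive_derive. lra.
  - intros z _. apply Rlt_le, gamma_integrand_pos.
Qed.

(** Only half of the exponential is spent on the power of [t]; the other half keeps
    [t ^ a exp (- t)] integrable. *)
Lemma Rpower_le_exp (a : R) : 0 <= a ->
  exists C, 0 < C /\ forall t, 0 < t -> Rpower t a <= C * exp (t / 2).
Proof.
  intro Ha. set (b := 2 * a + 1). assert (Hb : 0 < b) by (unfold b; lra).
  exists (exp (a * ln b)). split; [apply exp_pos |]. intros t Ht.
  unfold Rpower. rewrite <- exp_plus. apply exp_nondecreasing.
  assert (Hu : 0 < t / b) by now apply Rdiv_lt_0_compat.
  assert (Hln : ln (t / b) <= t / b).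
  { destruct (Rle_lt_dec (ln (t / b)) 0); [lra |].
    pose proof (exp_ineq1 (ln (t / b)) ltac:(lra)) as H. rewrite exp_ln in H; lra. }
  unfold Rdiv at 1 in Hln. rewrite ln_mult, ln_Rinv in Hln; auto using Rinv_0_lt_compat.
  assert (Hab : a * (t / b) <= t / 2).
  { apply Rmult_le_reg_r with (2 * b); [lra |]. unfold b in *. field_simplify; nra. }
  nra.
Qed.

Lemma monotone_limit (G : R -> R) (M : R) :
  (forall x y, 0 < x -> x <= y -> G x <= G y) ->
  (forall x, 0 < x -> G x <= M) ->
  exists l, filterlim G (Rbar_locally p_infty) (locally l) /\
    forall x, 0 < x -> G x <= l.
Proof.
  intros Hinc HM.
  destruct (completeness (fun y => exists x, 0 < x /\ y = G x)) as [l [Hub Hlub]].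
  - exists M. intros y [x [Hx ->]]. now apply HM.
  - exists (G 1), 1. split; [lra | reflexivity].
  - exists l. assert (Hl : forall x, 0 < x -> G x <= l).
    { intros x Hx. apply Hub. now exists x. }
    split; [| exact Hl].
    apply filterlim_locally. intro eps.
    assert (Hex : exists x0, 0 < x0 /\ l - eps < G x0).
    { apply NNPP. intro Hn. assert (l <= l - eps); [| destruct eps; simpl in *; lra].
      apply Hlub. intros y [x [Hx ->]]. apply Rnot_lt_le. intro Hlt.
      apply Hn. now exists x. }
    destruct Hex as [x0 [Hx0 Hlt]]. exists x0. intros x Hx.
    change (Rabs (G x - l) < eps).
    pose proof (Hinc x0 x Hx0 ltac:(lra)). pose proof (Hl x ltac:(lra)).
    apply Rabs_def1; destruct eps; simpl in *; lra.
Qed.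

Lemma gamma_primitive_limits (s : R) : 1 <= s -> exists l0 l1,
  filterlim (gamma_primitive s) (at_right 0) (locally l0) /\
  filterlim (gamma_primitive s) (Rbar_locally p_infty) (locally l1) /\ l0 < l1.
Proof.
  intro Hs.
  destruct (monotone_limit (fun u => - gamma_primitive s (/ u)) 1) as [l0 [Hl0 Hm0]].
  { intros x y Hx Hxy. apply Ropp_le_contravar, gamma_primitive_incr.
    - apply Rinv_0_lt_compat; lra.
    - apply Rinv_le_contravar; lra. }
  { intros u Hu. assert (Hi := Rinv_0_lt_compat u Hu).
    assert (H1 := gamma_primitive_1 s).
    destruct (Rle_lt_dec 1 (/ u)) as [H | H].
    - pose proof (gamma_primitive_incr s 1 (/ u) ltac:(lra) H). lra.
    - assert (/ u - gamma_primitive s (/ u) <= 1 - gamma_primitive s 1); [| lra].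
      apply (increasing_of_derive (fun x => x - gamma_primitive s x)
               (fun x => 1 - gamma_integrand s x)); [lra | |].
      + intros x Hx. apply (is_derive_difference (fun x => x) (gamma_primitive s)).
        * apply (is_derive_id x).
        * apply gamma_primitive_derive. lra.
      + intros x Hx. unfold gamma_integrand.
        assert (Rpower x (s - 1) <= 1).
        { unfold Rpower. apply exp_le_1.
          assert (ln x < 0) by (rewrite <- ln_1; apply ln_increasing; lra). nra. }
        assert (exp (- x) <= 1) by (apply exp_le_1; lra).
        assert (0 < Rpower x (s - 1)) by apply exp_pos.
        pose proof (exp_pos (- x)). nra. }
  destruct (Rpower_le_exp (s - 1) ltac:(lra)) as [C [HC Hpow]].
  destruct (monotone_limit (gamma_primitive s) (2 * C)) as [l1 [Hl1 Hm1]].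
  { apply gamma_primitive_incr. }
  { intros x Hx. destruct (Rle_lt_dec x 1) as [H | H].
    - pose proof (gamma_primitive_incr s x 1 Hx H) as H0.
      rewrite gamma_primitive_1 in H0. lra.
    - assert (Hle : - (2 * C * exp (- (1 / 2))) - gamma_primitive s 1
                    <= - (2 * C * exp (- (x / 2))) - gamma_primitive s x).
      { apply (increasing_of_derive
                 (fun x => - (2 * C * exp (- (x / 2))) - gamma_primitive s x)
                 (fun x => C * exp (- (x / 2)) - gamma_integrand s x)); [lra | |].
        - intros y Hy. apply (is_derive_difference
            (fun x => - (2 * C * exp (- (x / 2)))) (gamma_primitive s)).
          + auto_derive; [exact I | unfold Rdiv; field].
          + apply gamma_primitive_derive. lra.
        - intros y Hy. unfold gamma_integrand.
          specialize (Hpow y ltac:(lra)).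
          replace (exp (- (y / 2))) with (exp (y / 2) * exp (- y))
            by (rewrite <- exp_plus; f_equal; field).
          pose proof (exp_pos (- y)). nra. }
      rewrite gamma_primitive_1 in Hle.
      assert (exp (- (1 / 2)) <= 1) by (apply exp_le_1; lra).
      pose proof (exp_pos (- (x / 2))). nra. }
  exists (- l0), l1. split; [| split; [exact Hl1 |]].
  - apply (filterlim_ext_loc (fun x => - (- gamma_primitive s (/ / x)))).
    + exists (mkposreal 1 ltac:(lra)). intros x _ Hx.
      now rewrite Rinv_inv, Ropp_involutive.
    + apply (filterlim_comp _ _ _ (fun x => - gamma_primitive s (/ / x)) Ropp
               _ (locally l0)).
      * apply (filterlim_comp _ _ _ Rinv (fun u => - gamma_primitive s (/ u))
                 _ (Rbar_locally p_infty)); [apply filterlim_Rinv_0_right | exact Hl0].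
      * apply (filterlim_opp l0).
  - assert (H1 := Hm0 1 ltac:(lra)). rewrite Rinv_1 in H1.
    assert (H2 := Hm1 2 ltac:(lra)).
    assert (gamma_primitive s 1 < gamma_primitive s 2); [| lra].
    apply (strictly_increasing_of_derive _ (gamma_integrand s)); [lra | |].
    + intros z Hz. apply gamma_primitive_derive. lra.
    + intros z _. apply gamma_integrand_pos.
Qed.

Lemma filter_prod_pos :
  filter_prod (at_right 0) (Rbar_locally p_infty) (fun ab => 0 < fst ab /\ 0 < snd ab).
Proof.
  apply (Filter_prod _ _ _ (fun x => 0 < x) (fun x => 0 < x)).
  - exists (mkposreal 1 ltac:(lra)). intros x _ Hx. exact Hx.
  - exists 0. intros x Hx. exact Hx.
  - intros x y Hx Hy. now split.
Qed.

(** Newton-Leibniz on the half-line, in terms of the limits of a primitive. *)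
Lemma is_RInt_gen_primitive (F f : R -> R) (l0 l1 : R) :
  (forall x, 0 < x -> is_derive F x (f x)) ->
  (forall x, 0 < x -> continuous f x) ->
  filterlim F (at_right 0) (locally l0) ->
  filterlim F (Rbar_locally p_infty) (locally l1) ->
  is_RInt_gen f (at_right 0) (Rbar_locally p_infty) (l1 - l0).
Proof.
  intros HF Hf H0 H1.
  assert (Hpos : forall ab : R * R, 0 < fst ab /\ 0 < snd ab ->
            forall x, Rmin (fst ab) (snd ab) <= x -> 0 < x).
  { intros [a b] [Ha Hb] x Hx. eapply Rlt_le_trans; [| exact Hx].
    now apply Rmin_glb_lt. }
  apply (is_RInt_gen_ext (Derive F)).
  - refine (filter_imp _ _ _ filter_prod_pos). intros ab Hab x [Hx _].
    apply is_derive_unique, HF, (Hpos ab Hab). now apply Rlt_le.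
  - apply is_RInt_gen_Derive; [| | exact H0 | exact H1].
    + refine (filter_imp _ _ _ filter_prod_pos). intros ab Hab x [Hx _].
      exists (f x). now apply HF, (Hpos ab Hab).
    + refine (filter_imp _ _ _ filter_prod_pos). intros ab Hab x [Hx _].
      assert (H := Hpos ab Hab x Hx).
      apply (continuous_ext_loc _ f); [| now apply Hf].
      apply (filter_imp (fun y => 0 < y)); [| now apply locally_pos].
      intros y Hy. symmetry. now apply is_derive_unique, HF.
Qed.

Lemma is_RInt_gen_Gamma (s : R) : 1 <= s ->
  is_RInt_gen (gamma_integrand s) (at_right 0) (Rbar_locally p_infty) (Gamma s)
  /\ 0 < Gamma s.
Proof.
  intro Hs. destruct (gamma_primitive_limits s Hs) as [l0 [l1 [H0 [H1 Hlt]]]].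
  assert (H : is_RInt_gen (gamma_integrand s) (at_right 0) (Rbar_locally p_infty) (l1 - l0)).
  { apply (is_RInt_gen_primitive (gamma_primitive s)); auto.
    - intros; now apply gamma_primitive_derive.
    - intros; now apply gamma_integrand_continuous. }
  assert (E : Gamma s = l1 - l0).
  { apply (is_RInt_gen_unique (gamma_integrand s)). exact H. }
  rewrite E. split; [exact H | lra].
Qed.

Lemma Gamma_pos (s : R) : 1 <= s -> 0 < Gamma s.
Proof. intro Hs. now apply is_RInt_gen_Gamma. Qed.

Lemma Rpower_exp_lim_infty (s : R) : 1 <= s ->
  filterlim (fun t => Rpower t s * exp (- t)) (Rbar_locally p_infty) (locally 0).
Proof.
  intro Hs. destruct (Rpower_le_exp s ltac:(lra)) as [C [HC Hpow]].
  apply (filterlim_le_le (F := Rbar_locally p_infty) (fun _ => 0) _ (fun t => C * exp (- (t / 2))) 0).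
  - exists 0. intros t Ht. specialize (Hpow t Ht). split.
    + apply Rlt_le, Rmult_lt_0_compat; apply exp_pos.
    + replace (exp (- (t / 2))) with (exp (t / 2) * exp (- t))
        by (rewrite <- exp_plus; f_equal; field).
      pose proof (exp_pos (- t)). nra.
  - apply filterlim_const.
  - apply filterlim_locally. intros [eps Heps].
    exists (2 * (C / eps)). intros t Ht. change (Rabs (C * exp (- (t / 2)) - 0) < eps).
    assert (Hq : 0 < C / eps) by now apply Rdiv_lt_0_compat.
    rewrite Rminus_0_r, Rabs_pos_eq
      by (apply Rlt_le, Rmult_lt_0_compat; [exact HC | apply exp_pos]).
    rewrite exp_Ropp.
    assert (He : t / 2 < exp (t / 2)) by (pose proof (exp_ineq1 (t / 2) ltac:(lra)); lra).
    assert (Hc : C < eps * exp (t / 2)).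
    { replace C with (eps * (C / eps)) by (field; lra). apply Rmult_lt_compat_l; lra. }
    apply Rmult_lt_reg_r with (exp (t / 2)); [apply exp_pos |].
    rewrite Rmult_assoc, Rinv_l, Rmult_1_r; [exact Hc |].
    pose proof (exp_pos (t / 2)). lra.
Qed.

Lemma Rpower_exp_lim_0 (s : R) : 1 <= s ->
  filterlim (fun t => Rpower t s * exp (- t)) (at_right 0) (locally 0).
Proof.
  intro Hs. apply filterlim_locally. intros [eps Heps].
  exists (mkposreal (Rmin eps 1) ltac:(apply Rmin_glb_lt; lra)).
  intros t Ht Htp. change (Rabs (t - 0) < Rmin eps 1) in Ht.
  change (Rabs (Rpower t s * exp (- t) - 0) < eps).
  rewrite Rminus_0_r, Rabs_pos_eq in Ht by lra.
  pose proof (Rmin_l eps 1). pose proof (Rmin_r eps 1).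
  assert (Hp : 0 < Rpower t s) by apply exp_pos.
  assert (Hle : Rpower t s <= t).
  { unfold Rpower. rewrite <- (exp_ln t Htp) at 2. apply exp_nondecreasing.
    assert (ln t < 0) by (rewrite <- ln_1; apply ln_increasing; lra). nra. }
  assert (exp (- t) <= 1) by (apply exp_le_1; lra).
  pose proof (exp_pos (- t)).
  rewrite Rminus_0_r, Rabs_pos_eq by (apply Rlt_le, Rmult_lt_0_compat; auto).
  nra.
Qed.

(** Integration by parts: both boundary terms of [- t ^ s exp (- t)] vanish. *)
Lemma Gamma_succ (s : R) : 1 <= s -> Gamma (s + 1) = s * Gamma s.
Proof.
  intro Hs.
  destruct (is_RInt_gen_Gamma s Hs) as [Hg _].
  destruct (is_RInt_gen_Gamma (s + 1) ltac:(lra)) as [Hg1 _].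
  assert (Hi := is_RInt_gen_minus _ _ _ _ Hg1 (is_RInt_gen_scal _ s _ Hg)).
  assert (Hp : is_RInt_gen (fun t => minus (gamma_integrand (s + 1) t) (scal s (gamma_integrand s t)))
            (at_right 0) (Rbar_locally p_infty) (- 0 - - 0)).
  { apply (is_RInt_gen_primitive (fun t => - (Rpower t s * exp (- t)))).
    - intros x Hx. eapply is_derive_value.
      + apply (is_derive_opp (fun t => Rpower t s * exp (- t))).
        apply (is_derive_product (fun t => Rpower t s) (fun t => exp (- t)));
          [now apply is_derive_Rpower |].
        instantiate (1 := - exp (- x)). auto_derive; [exact I | ring].
      + unfold gamma_integrand, minus, scal, plus, opp; simpl. unfold mult; simpl.
        replace (s + 1 - 1) with s by ring. unfold Rminus.
        rewrite Rpower_plus, Rpower_Ropp, Rpower_1 by exact Hx. field. lra.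
    - intros x Hx. apply (continuous_minus (gamma_integrand (s + 1))
                            (fun t => scal s (gamma_integrand s t))).
      + now apply gamma_integrand_continuous.
      + apply (continuous_scal_r s (gamma_integrand s)).
        now apply gamma_integrand_continuous.
    - apply (filterlim_comp _ _ _ (fun t => Rpower t s * exp (- t)) Ropp _ (locally 0));
        [now apply Rpower_exp_lim_0 | apply (filterlim_opp 0)].
    - apply (filterlim_comp _ _ _ (fun t => Rpower t s * exp (- t)) Ropp _ (locally 0));
        [now apply Rpower_exp_lim_infty | apply (filterlim_opp 0)]. }
  assert (E := eq_trans (eq_sym (is_RInt_gen_unique _ _ Hi)) (is_RInt_gen_unique _ _ Hp)).
  unfold minus, scal, plus, opp in E; simpl in E. unfold mult in E; simpl in E. lra.
Qed.

(** * Roots of continuous functions *)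

Lemma continuous_pos_near (f : R -> R) (x : R) : continuous f x -> 0 < f x ->
  exists d, 0 < d /\ forall y, x - d < y < x + d -> 0 < f y.
Proof.
  intros Hc Hp. destruct (Hc _ (locally_pos _ Hp)) as [d Hd].
  exists d. split; [apply cond_pos |]. intros y Hy. apply Hd.
  change (Rabs (y - x) < d). apply Rabs_def1; lra.
Qed.

Lemma first_root_pos (f : R -> R) (a b : R) : a < b ->
  (forall x, a <= x <= b -> continuous f x) -> 0 < f a -> f b <= 0 ->
  exists c, a < c <= b /\ f c = 0 /\ forall x, a <= x < c -> 0 < f x.
Proof.
  intros Hab Hc Ha Hb.
  destruct (completeness (fun x => a <= x <= b /\ forall t, a <= t <= x -> 0 < f t))
    as [c [Hub Hlub]].
  - exists b. intros x [Hx _]. lra.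
  - exists a. split; [lra |]. intros t Ht. now replace t with a by lra.
  - assert (Hac : a <= c).
    { apply Hub. split; [lra |]. intros t Ht. now replace t with a by lra. }
    assert (Hcb : c <= b) by (apply Hlub; intros x [Hx _]; lra).
    assert (Hleft : forall x, a <= x < c -> 0 < f x).
    { intros x Hx. apply NNPP. intro Hn. assert (c <= x); [| lra].
      apply Hlub. intros y [Hy Hpos]. apply Rnot_lt_le. intro Hlt.
      apply Hn, Hpos. lra. }
    assert (Hle : f c <= 0).
    { apply Rnot_lt_le. intro Hpos.
      assert (c <> b) by (intros ->; lra).
      destruct (continuous_pos_near f c (Hc c ltac:(lra)) Hpos) as [d [Hd Hnear]].
      assert (Hm : c < Rmin b (c + d / 2)) by (apply Rmin_glb_lt; lra).
      assert (Rmin b (c + d / 2) <= c); [| lra].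
      pose proof (Rmin_l b (c + d / 2)). pose proof (Rmin_r b (c + d / 2)).
      apply Hub. split; [lra |]. intros t Ht.
      destruct (Rlt_le_dec t c); [apply Hleft; lra | apply Hnear; lra]. }
    assert (Hne : a <> c) by (intros ->; lra).
    assert (Hge : 0 <= f c).
    { apply Rnot_lt_le. intro Hneg.
      destruct (continuous_pos_near (fun x => - f x) c) as [d [Hd Hnear]].
      - apply (continuous_opp f), Hc. lra.
      - lra.
      - pose proof (Rmax_l a (c - d / 2)). pose proof (Rmax_r a (c - d / 2)).
        assert (Rmax a (c - d / 2) < c) by (apply Rmax_lub_lt; lra).
        specialize (Hnear (Rmax a (c - d / 2)) ltac:(lra)).
        specialize (Hleft (Rmax a (c - d / 2)) ltac:(lra)). lra. }
    exists c. repeat split; try lra. exact Hleft.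
Qed.

Lemma first_root (f : R -> R) (a b : R) : a < b ->
  (forall x, a <= x <= b -> continuous f x) -> f a <> 0 -> f b = 0 ->
  exists c, a < c <= b /\ f c = 0 /\ forall x, a <= x < c -> f x <> 0.
Proof.
  intros Hab Hc Ha Hb. destruct (Rlt_le_dec 0 (f a)) as [Hp | Hn].
  - destruct (first_root_pos f a b Hab Hc Hp ltac:(lra)) as [c [H1 [H2 H3]]].
    exists c. repeat split; try tauto. intros x Hx. specialize (H3 x Hx). lra.
  - destruct (first_root_pos (fun x => - f x) a b Hab) as [c [H1 [H2 H3]]];
      [| lra | lra |].
    { intros x Hx. now apply (continuous_opp f), Hc. }
    exists c. repeat split; try tauto; [lra |]. intros x Hx. specialize (H3 x Hx). lra.
Qed.

Lemma nonvanishing_sign (f : R -> R) (a b : R) :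
  (forall x, a < x < b -> continuous f x) -> (forall x, a < x < b -> f x <> 0) ->
  (forall x, a < x < b -> 0 < f x) \/ (forall x, a < x < b -> 0 < - f x).
Proof.
  intros Hc Hn.
  assert (Hlt : forall g : R -> R, (forall x, a < x < b -> continuous g x) ->
            (forall x, a < x < b -> g x <> 0) ->
            forall x y, a < x < b -> a < y < b -> x < y -> 0 < g x -> 0 < g y).
  { intros g Hgc Hgn x y Hx Hy Hxy Hp. apply Rnot_le_lt. intro Hle.
    destruct (first_root_pos g x y Hxy) as [c [H1 [H2 _]]]; auto.
    - intros t Ht. apply Hgc. lra.
    - apply (Hgn c); [lra | exact H2]. }
  assert (Hc' : forall x, a < x < b -> continuous (fun x => - f x) x).
  { intros x Hx. now apply (continuous_opp f), Hc. }
  assert (Hn' : forall x, a < x < b -> - f x <> 0).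
  { intros x Hx. specialize (Hn x Hx). lra. }
  destruct (Rlt_le_dec a b) as [Hab | Hab]; [| left; intros; lra].
  assert (Hm : a < (a + b) / 2 < b) by lra.
  assert (Hall : forall x, a < x < b -> (0 < f x <-> 0 < f ((a + b) / 2))).
  { intros x Hx. specialize (Hn x Hx) as Hnx. specialize (Hn _ Hm) as Hnm.
    destruct (Rtotal_order x ((a + b) / 2)) as [H | [-> | H]]; [| tauto |]; split; intro Hp.
    - now apply (Hlt f Hc Hn x).
    - apply Rnot_le_lt. intro Hle.
      pose proof (Hlt _ Hc' Hn' x _ Hx Hm H ltac:(lra)). lra.
    - apply Rnot_le_lt. intro Hle.
      pose proof (Hlt _ Hc' Hn' _ x Hm Hx H ltac:(lra)). lra.
    - now apply (Hlt f Hc Hn ((a + b) / 2)). }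
  destruct (Rlt_le_dec 0 (f ((a + b) / 2))) as [Hp | Hp].
  - left. intros x Hx. now apply Hall.
  - right. intros x Hx. specialize (Hn x Hx). destruct (Hall x Hx) as [H _].
    destruct (Rlt_le_dec 0 (f x)); [specialize (H r) |]; lra.
Qed.

(** * The power series of the Bessel function *)

Definition bessel_coef (nu : R) (m : nat) : R :=
  (-1) ^ m / (INR (fact m) * Gamma (INR m + nu + 1)).

(** The entire function [(x / 2) ^ (- nu) J_nu(x)], as a function of [(x / 2) ^ 2]. *)
Definition bessel_series (nu u : R) : R := PSeries (bessel_coef nu) u.

Lemma bessel_coef_denominator (nu : R) (m : nat) : 0 <= nu ->
  0 < INR (fact m) /\ 0 < INR m + nu + 1 /\ 0 < Gamma (INR m + nu + 1).
Proof.
  intro Hnu. assert (Hm := pos_INR m). repeat split; try lra.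
  - apply INR_fact_lt_0.
  - apply Gamma_pos. lra.
Qed.

Lemma bessel_coef_neq_0 (nu : R) (m : nat) : 0 <= nu -> bessel_coef nu m <> 0.
Proof.
  intro Hnu. destruct (bessel_coef_denominator nu m Hnu) as [Hf [_ Hg]].
  unfold bessel_coef. apply Rmult_integral_contrapositive_currified.
  - apply pow_nonzero. lra.
  - apply Rinv_neq_0_compat, Rgt_not_eq, Rmult_lt_0_compat; assumption.
Qed.

Lemma bessel_coef_succ (nu : R) (m : nat) : 0 <= nu ->
  bessel_coef nu (S m) = - bessel_coef nu m / (INR (S m) * (INR m + nu + 1)).
Proof.
  intro Hnu. destruct (bessel_coef_denominator nu m Hnu) as [Hf [Hm Hg]].
  unfold bessel_coef. rewrite fact_simpl, mult_INR.
  replace (INR (S m) + nu + 1) with (INR m + nu + 1 + 1) by (rewrite S_INR; ring).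
  pose proof (pos_INR m). rewrite (Gamma_succ (INR m + nu + 1)) by lra.
  rewrite S_INR. simpl pow.
  field. repeat split; lra.
Qed.

Lemma bessel_coef_nu_succ (nu : R) (m : nat) : 0 <= nu ->
  bessel_coef nu m = (INR m + nu + 1) * bessel_coef (nu + 1) m.
Proof.
  intro Hnu. destruct (bessel_coef_denominator nu m Hnu) as [Hf [Hm Hg]].
  unfold bessel_coef.
  replace (INR m + (nu + 1) + 1) with (INR m + nu + 1 + 1) by ring.
  pose proof (pos_INR m). rewrite (Gamma_succ (INR m + nu + 1)) by lra.
  field. repeat split; lra.
Qed.

Lemma bessel_coef_radius (nu : R) : 0 <= nu -> CV_radius (bessel_coef nu) = p_infty.
Proof.
  intro Hnu. apply CV_radius_infinite_DAlembert.
  - intro m. now apply bessel_coef_neq_0.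
  - apply (is_lim_seq_le_le (fun _ => 0) _ (fun m => / INR (S m))).
    + intro m. split; [apply Rabs_pos |].
      rewrite bessel_coef_succ by exact Hnu.
      assert (Hm := pos_INR m). assert (Hc := bessel_coef_neq_0 nu m Hnu).
      rewrite S_INR.
      replace (- bessel_coef nu m / ((INR m + 1) * (INR m + nu + 1)) / bessel_coef nu m)
        with (- / ((INR m + 1) * (INR m + nu + 1))) by (field; repeat split; lra).
      rewrite Rabs_Ropp, Rabs_pos_eq.
      * apply Rinv_le_contravar; nra.
      * apply Rlt_le, Rinv_0_lt_compat. nra.
    + apply is_lim_seq_const.
    + apply (is_lim_seq_incr_1 (fun m => / INR m)).
      apply (is_lim_seq_inv INR p_infty); [apply is_lim_seq_INR | discriminate].
Qed.

Lemma bessel_series_ex (nu u : R) : 0 <= nu -> ex_pseries (bessel_coef nu) u.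
Proof.
  intro Hnu. apply CV_disk_correct, CV_disk_inside.
  rewrite bessel_coef_radius by exact Hnu. exact I.
Qed.

Lemma PS_derive_bessel_coef (nu : R) (m : nat) : 0 <= nu ->
  PS_derive (bessel_coef nu) m = - bessel_coef (nu + 1) m.
Proof.
  intro Hnu. unfold PS_derive. rewrite bessel_coef_succ, bessel_coef_nu_succ by exact Hnu.
  pose proof (pos_INR m). rewrite S_INR. field. lra.
Qed.

Lemma bessel_series_derive (nu u : R) : 0 <= nu ->
  is_derive (bessel_series nu) u (- bessel_series (nu + 1) u).
Proof.
  intro Hnu. eapply is_derive_value.
  - apply is_derive_PSeries. rewrite bessel_coef_radius by exact Hnu. exact I.
  - unfold bessel_series. rewrite <- PSeries_opp. apply PSeries_ext.
    intro m. now rewrite PS_derive_bessel_coef.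
Qed.

Lemma bessel_series_contiguous (nu u : R) : 0 <= nu ->
  bessel_series nu u
  = (nu + 1) * bessel_series (nu + 1) u - u * bessel_series (nu + 2) u.
Proof.
  intro Hnu. unfold bessel_series.
  rewrite (PSeries_ext (bessel_coef nu)
             (PS_plus (PS_scal (nu + 1) (bessel_coef (nu + 1)))
                (PS_incr_1 (PS_derive (bessel_coef (nu + 1)))))).
  - rewrite PSeries_plus, PSeries_scal, PSeries_incr_1.
    + rewrite (PSeries_ext (PS_derive (bessel_coef (nu + 1)))
                 (PS_opp (bessel_coef (nu + 2)))).
      * rewrite PSeries_opp. ring.
      * intro m. rewrite PS_derive_bessel_coef by lra.
        unfold PS_opp, opp; simpl. do 2 f_equal. ring.
    + apply ex_pseries_scal; [apply Rmult_comm | apply bessel_series_ex; lra].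
    + apply ex_pseries_incr_1, CV_disk_correct, CV_disk_inside.
      rewrite CV_radius_derive, bessel_coef_radius by lra. exact I.
  - intro m. rewrite bessel_coef_nu_succ by exact Hnu.
    unfold PS_plus, PS_scal, PS_incr_1, PS_derive.
    destruct m as [| m]; unfold plus, scal; cbn -[INR]; unfold mult; cbn -[INR].
    + unfold zero; simpl. ring.
    + rewrite S_INR. ring.
Qed.

Lemma BesselJ_series (nu x : R) : 0 < x ->
  BesselJ nu x = Rpower (x / 2) nu * bessel_series nu ((x / 2) ^ 2).
Proof.
  intro Hx. unfold BesselJ, bessel_series, PSeries. rewrite <- Series_scal_l.
  apply Series_ext. intro m. fold (bessel_coef nu m).
  rewrite Rpower_plus.
  replace (2 * INR m) with (INR (2 * m)) by (rewrite mult_INR; simpl; ring).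
  rewrite Rpower_pow, pow_mult by lra. ring.
Qed.

Lemma BesselJ_succ_series (nu x : R) : 0 < x ->
  BesselJ (nu + 1) x = Rpower (x / 2) nu * (x / 2 * bessel_series (nu + 1) ((x / 2) ^ 2)).
Proof.
  intro Hx. rewrite BesselJ_series, Rpower_plus, Rpower_1 by lra. ring.
Qed.

Lemma scaled_series_derive (nu x : R) : 0 <= nu ->
  is_derive (fun x => bessel_series nu ((x / 2) ^ 2)) x
    (- (x / 2) * bessel_series (nu + 1) ((x / 2) ^ 2)).
Proof.
  intro Hnu. eapply is_derive_value.
  - apply (is_derive_compose (bessel_series nu) (fun x => (x / 2) ^ 2)).
    + now apply bessel_series_derive.
    + instantiate (1 := x / 2). auto_derive; [exact I | field].
  - ring.
Qed.

Lemma half_Rpower_derive (a x : R) : 0 < x ->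
  is_derive (fun x => Rpower (x / 2) a) x (a / x * Rpower (x / 2) a).
Proof.
  intro Hx. eapply is_derive_value.
  - apply (is_derive_compose (fun t => Rpower t a) (fun x => x / 2)).
    + apply is_derive_Rpower. lra.
    + instantiate (1 := / 2). auto_derive; [exact I | field].
  - field. lra.
Qed.

Lemma BesselJ_derive (nu x : R) : 0 <= nu -> 0 < x ->
  is_derive (BesselJ nu) x (nu / x * BesselJ nu x - BesselJ (nu + 1) x).
Proof.
  intros Hnu Hx.
  apply (is_derive_ext_loc (fun x => Rpower (x / 2) nu * bessel_series nu ((x / 2) ^ 2))).
  - apply (filter_imp (fun y => 0 < y)); [| now apply locally_pos].
    intros y Hy. now rewrite BesselJ_series.
  - rewrite BesselJ_series, BesselJ_succ_series by exact Hx. eapply is_derive_value.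
    + apply (is_derive_product (fun x => Rpower (x / 2) nu)
               (fun x => bessel_series nu ((x / 2) ^ 2))).
      * now apply half_Rpower_derive.
      * now apply scaled_series_derive.
    + ring.
Qed.

Lemma BesselJ_succ_derive (nu x : R) : 0 <= nu -> 0 < x ->
  is_derive (BesselJ (nu + 1)) x (BesselJ nu x - (nu + 1) / x * BesselJ (nu + 1) x).
Proof.
  intros Hnu Hx. eapply is_derive_value.
  - apply BesselJ_derive; lra.
  - rewrite (BesselJ_succ_series (nu + 1)), BesselJ_succ_series, BesselJ_series by exact Hx.
    rewrite (bessel_series_contiguous nu) by exact Hnu.
    replace (nu + 1 + 1) with (nu + 2) by ring.
    rewrite Rpower_plus, Rpower_1 by lra. field. lra.
Qed.

(** [x] times the derivative of [J_nu]. *)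
Definition BesselJ' (nu x : R) : R := nu * BesselJ nu x - x * BesselJ (nu + 1) x.

(** Second order equations in the logarithmic variable: with [D := x d/dx],
    [y] solves [D (D y) = - Q y] to the right of [lo], and [Dy] is [D y]. *)
Definition solves (Q y Dy : R -> R) (lo : R) : Prop :=
  forall x, lo < x -> is_derive y x (Dy x / x) /\ is_derive Dy x (- Q x * y x / x).

Lemma BesselJ_solves (nu : R) : 0 <= nu ->
  solves (fun x => x ^ 2 - nu ^ 2) (BesselJ nu) (BesselJ' nu) 0.
Proof.
  intros Hnu x Hx. split.
  - eapply is_derive_value; [now apply BesselJ_derive |]. unfold BesselJ'. field. lra.
  - eapply is_derive_value.
    + apply (is_derive_difference (fun x => nu * BesselJ nu x) (fun x => x * BesselJ (nu + 1) x)).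
      * apply (is_derive_scal (BesselJ nu)). now apply BesselJ_derive.
      * apply (is_derive_product (fun x => x) (BesselJ (nu + 1))); [apply (is_derive_id x) |].
        now apply BesselJ_succ_derive.
    + unfold one; simpl. field. lra.
Qed.

Lemma BesselJ_continuous (nu x : R) : 0 <= nu -> 0 < x -> continuous (BesselJ nu) x.
Proof. intros Hnu Hx. eapply derive_continuous. now apply BesselJ_derive. Qed.

Lemma bessel_series_0_pos (nu : R) : 0 <= nu -> 0 < bessel_series nu 0.
Proof.
  intro Hnu. unfold bessel_series. rewrite PSeries_0.
  destruct (bessel_coef_denominator nu 0 Hnu) as [Hf [_ Hg]].
  unfold bessel_coef. simpl pow. apply Rdiv_lt_0_compat; [lra | nra].
Qed.

(** Near the origin a combination of Bessel functions has the sign of its leading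
    term; [g] is that combination stripped of its power of [x]. *)
Lemma positive_near_0 (g : R -> R) : continuous g 0 -> 0 < g 0 ->
  exists d, 0 < d /\ forall x, 0 < x < d -> 0 < g ((x / 2) ^ 2).
Proof.
  intros Hc Hp. destruct (continuous_pos_near g 0 Hc Hp) as [d [Hd Hnear]].
  exists (Rmin d 1). split; [apply Rmin_glb_lt; lra |].
  pose proof (Rmin_l d 1). pose proof (Rmin_r d 1).
  intros x Hx. apply Hnear. nra.
Qed.

Lemma bessel_series_continuous (nu u : R) : 0 <= nu -> continuous (bessel_series nu) u.
Proof. intro Hnu. eapply derive_continuous. now apply bessel_series_derive. Qed.

Lemma BesselJ_pos_near_0 (nu : R) : 0 <= nu ->
  exists d, 0 < d /\ forall x, 0 < x < d -> 0 < BesselJ nu x.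
Proof.
  intro Hnu. destruct (positive_near_0 (bessel_series nu)) as [d [Hd Hpos]].
  - now apply bessel_series_continuous.
  - now apply bessel_series_0_pos.
  - exists d. split; [exact Hd |]. intros x Hx. rewrite BesselJ_series by lra.
    apply Rmult_lt_0_compat; [apply exp_pos | now apply Hpos].
Qed.

Lemma BesselJ'_pos_near_0 (nu : R) : 0 < nu ->
  exists d, 0 < d /\ forall x, 0 < x < d -> 0 < BesselJ' nu x.
Proof.
  intro Hnu.
  destruct (positive_near_0
    (fun u => nu * bessel_series nu u - 2 * (u * bessel_series (nu + 1) u))) as [d [Hd Hpos]].
  - apply (continuous_minus (fun u => nu * bessel_series nu u)
             (fun u => 2 * (u * bessel_series (nu + 1) u))).
    + apply (continuous_scal_r nu (bessel_series nu)), bessel_series_continuous. lra.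
    + apply (continuous_scal_r 2 (fun u => u * bessel_series (nu + 1) u)).
      apply (continuous_mult (fun u => u) (bessel_series (nu + 1))).
      * apply continuous_id.
      * apply bessel_series_continuous. lra.
  - pose proof (bessel_series_0_pos nu ltac:(lra)). nra.
  - exists d. split; [exact Hd |]. intros x Hx. unfold BesselJ'.
    rewrite BesselJ_succ_series, BesselJ_series by lra.
    specialize (Hpos x Hx).
    replace (nu * _ - _) with (Rpower (x / 2) nu *
      (nu * bessel_series nu ((x / 2) ^ 2)
       - 2 * ((x / 2) ^ 2 * bessel_series (nu + 1) ((x / 2) ^ 2)))) by field.
    apply Rmult_lt_0_compat; [apply exp_pos | exact Hpos].
Qed.

(** In the barrier [x <= nu], [D (D J) = (nu ^ 2 - x ^ 2) J] makes [J] convex in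
    the logarithmic variable, so [J], which starts out increasing, cannot return to [0]. *)
Lemma BesselJ_pos_barrier (nu x : R) : 0 < x <= nu -> 0 < BesselJ nu x.
Proof.
  intro Hx. apply Rnot_le_lt. intro Hneg.
  destruct (BesselJ_pos_near_0 nu ltac:(lra)) as [d1 [Hd1 Hp1]].
  destruct (BesselJ'_pos_near_0 nu ltac:(lra)) as [d2 [Hd2 Hp2]].
  set (a := Rmin d1 d2 / 2).
  assert (Ha : 0 < a < d1 /\ a < d2).
  { pose proof (Rmin_l d1 d2). pose proof (Rmin_r d1 d2).
    pose proof (Rmin_glb_lt d1 d2 0 Hd1 Hd2). unfold a. lra. }
  assert (Hax : a < x).
  { apply Rnot_le_lt. intro H. specialize (Hp1 x ltac:(lra)). lra. }
  destruct (first_root_pos (BesselJ nu) a x Hax) as [c [Hc [Hc0 Hleft]]];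
    [| apply Hp1; lra | exact Hneg |].
  { intros t Ht. apply BesselJ_continuous; lra. }
  assert (Hinc : BesselJ nu a <= BesselJ nu c).
  { apply (increasing_of_derive _ (fun t => BesselJ' nu t / t)); [lra | |].
    - intros t Ht. apply (BesselJ_solves nu); lra.
    - intros t Ht. apply Rlt_le, Rdiv_lt_0_compat; [| lra].
      apply Rlt_le_trans with (BesselJ' nu a); [apply Hp2; lra |].
      apply (increasing_of_derive _ (fun t => - (t ^ 2 - nu ^ 2) * BesselJ nu t / t)); [lra | |].
      + intros s Hs. apply (BesselJ_solves nu); lra.
      + intros s Hs. specialize (Hleft s ltac:(lra)).
        apply Rlt_le, Rdiv_lt_0_compat; [apply Rmult_lt_0_compat; nra | lra]. }
  specialize (Hp1 a ltac:(lra)). lra.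
Qed.

(** [x ^ (2 nu + 2) (J_nu ^ 2 + J_(nu + 1) ^ 2)] is nondecreasing, and positive near [0]. *)
Lemma BesselJ_no_common_zero (nu x : R) : 0 <= nu -> 0 < x ->
  BesselJ nu x = 0 -> BesselJ (nu + 1) x = 0 -> False.
Proof.
  intros Hnu Hx H0 H1.
  destruct (BesselJ_pos_near_0 nu Hnu) as [d [Hd Hp]].
  set (a := Rmin (d / 2) x).
  assert (Ha : 0 < a < d /\ a <= x).
  { pose proof (Rmin_l (d / 2) x). pose proof (Rmin_r (d / 2) x).
    pose proof (Rmin_glb_lt (d / 2) x 0 ltac:(lra) Hx). unfold a. lra. }
  set (G := fun t => Rpower t (2 * nu + 2) * (BesselJ nu t ^ 2 + BesselJ (nu + 1) t ^ 2)).
  assert (HG : G a <= G x).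
  { apply (increasing_of_derive G
      (fun t => Rpower t (2 * nu + 2) * ((4 * nu + 2) / t * BesselJ nu t ^ 2))); [lra | |].
    - intros t Ht. eapply is_derive_value.
      + apply (is_derive_product (fun t => Rpower t (2 * nu + 2))
                 (fun t => BesselJ nu t ^ 2 + BesselJ (nu + 1) t ^ 2));
          [apply is_derive_Rpower; lra |].
        apply (is_derive_sum (fun t => BesselJ nu t ^ 2) (fun t => BesselJ (nu + 1) t ^ 2));
          apply is_derive_square.
        * apply BesselJ_derive; lra.
        * apply BesselJ_succ_derive; lra.
      + field. lra.
    - intros t Ht. apply Rmult_le_pos; [apply Rlt_le, exp_pos |].
      apply Rmult_le_pos; [apply Rlt_le, Rdiv_lt_0_compat; lra | apply pow2_ge_0]. }
  unfold G in HG. rewrite H0, H1 in HG.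
  specialize (Hp a ltac:(lra)).
  assert (0 < Rpower a (2 * nu + 2)) by apply exp_pos.
  assert (0 < Rpower a (2 * nu + 2) * (BesselJ nu a ^ 2 + BesselJ (nu + 1) a ^ 2))
    by (apply Rmult_lt_0_compat; nra).
  lra.
Qed.

(** * Sturm comparison *)

Lemma solves_opp (Q y Dy : R -> R) (lo : R) :
  solves Q y Dy lo -> solves Q (fun x => - y x) (fun x => - Dy x) lo.
Proof.
  intros H x Hx. destruct (H x Hx) as [H1 H2]. split; eapply is_derive_value.
  - apply (is_derive_opp y), H1.
  - unfold opp; simpl. unfold Rdiv. ring.
  - apply (is_derive_opp Dy), H2.
  - unfold opp; simpl. unfold Rdiv. ring.
Qed.

Lemma solves_weaken (Q y Dy : R -> R) (lo lo' : R) : lo <= lo' ->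
  solves Q y Dy lo -> solves Q y Dy lo'.
Proof. intros Hle H x Hx. apply H. lra. Qed.

Lemma solves_continuous (Q y Dy : R -> R) (lo x : R) :
  solves Q y Dy lo -> lo < x -> continuous y x.
Proof. intros H Hx. exact (derive_continuous y x _ (proj1 (H x Hx))). Qed.

Lemma derive_pos_crossing (f : R -> R) (x l : R) : is_derive f x l -> 0 < l -> f x = 0 ->
  exists d, 0 < d /\ (forall y, x - d < y < x -> f y < 0) /\ (forall y, x < y < x + d -> 0 < f y).
Proof.
  intros Hd Hl H0. apply is_derive_Reals in Hd. destruct (Hd l Hl) as [d Hnear].
  assert (Hq : forall h, h <> 0 -> Rabs h < d -> 0 < f (x + h) / h).
  { intros h Hh Hhd. specialize (Hnear h Hh Hhd).
    rewrite H0, Rminus_0_r in Hnear. apply Rabs_def2 in Hnear. lra. }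
  exists d. split; [apply cond_pos | split]; intros y Hy.
  - specialize (Hq (y - x) ltac:(lra) ltac:(apply Rabs_def1; lra)).
    replace (x + (y - x)) with y in Hq by ring.
    assert (f y = f y / (y - x) * (y - x)) by (field; lra). nra.
  - specialize (Hq (y - x) ltac:(lra) ltac:(apply Rabs_def1; lra)).
    replace (x + (y - x)) with y in Hq by ring.
    assert (f y = f y / (y - x) * (y - x)) by (field; lra). nra.
Qed.

Lemma derive_at_left_root (f : R -> R) (a b l : R) : a < b -> is_derive f a l -> f a = 0 ->
  (forall x, a < x < b -> 0 < f x) -> 0 <= l.
Proof.
  intros Hab Hd H0 Hpos. apply Rnot_lt_le. intro Hl.
  destruct (derive_pos_crossing (fun x => - f x) a (- l)) as [d [Hd0 [_ Hr]]]; try lra.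
  { apply (is_derive_opp f), Hd. }
  pose proof (Rmin_glb_lt d (b - a) 0 Hd0 ltac:(lra)).
  pose proof (Rmin_l d (b - a)). pose proof (Rmin_r d (b - a)).
  specialize (Hr (a + Rmin d (b - a) / 2) ltac:(lra)).
  specialize (Hpos (a + Rmin d (b - a) / 2) ltac:(lra)). lra.
Qed.

Lemma derive_at_right_root (f : R -> R) (a b l : R) : a < b -> is_derive f b l -> f b = 0 ->
  (forall x, a < x < b -> 0 < f x) -> l <= 0.
Proof.
  intros Hab Hd H0 Hpos. apply Rnot_lt_le. intro Hl.
  destruct (derive_pos_crossing f b l Hd Hl H0) as [d [Hd0 [Hr _]]].
  pose proof (Rmin_glb_lt d (b - a) 0 Hd0 ltac:(lra)).
  pose proof (Rmin_l d (b - a)). pose proof (Rmin_r d (b - a)).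
  specialize (Hr (b - Rmin d (b - a) / 2) ltac:(lra)).
  specialize (Hpos (b - Rmin d (b - a) / 2) ltac:(lra)). lra.
Qed.

Lemma nonneg_at_endpoint (f : R -> R) (a b c : R) : a < b -> c = a \/ c = b ->
  continuous f c -> (forall x, a < x < b -> 0 < f x) -> 0 <= f c.
Proof.
  intros Hab Hcab Hc Hpos. apply Rnot_lt_le. intro Hneg.
  destruct (continuous_pos_near (fun x => - f x) c) as [d [Hd Hnear]]; [| lra |].
  { now apply (continuous_opp f). }
  pose proof (Rmin_glb_lt d (b - a) 0 Hd ltac:(lra)).
  pose proof (Rmin_l d (b - a)). pose proof (Rmin_r d (b - a)).
  destruct Hcab as [-> | ->].
  - specialize (Hnear (a + Rmin d (b - a) / 2) ltac:(lra)).
    specialize (Hpos (a + Rmin d (b - a) / 2) ltac:(lra)). lra.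
  - specialize (Hnear (b - Rmin d (b - a) / 2) ltac:(lra)).
    specialize (Hpos (b - Rmin d (b - a) / 2) ltac:(lra)). lra.
Qed.

Lemma wronskian_derive (Qy y Dy Qv v Dv : R -> R) (lo x : R) : 0 <= lo ->
  solves Qy y Dy lo -> solves Qv v Dv lo -> lo < x ->
  is_derive (fun x => y x * Dv x - v x * Dy x) x ((Qy x - Qv x) * (v x * y x) / x).
Proof.
  intros Hlo Hy Hv Hx. destruct (Hy x Hx) as [H1 H2]. destruct (Hv x Hx) as [H3 H4].
  eapply is_derive_value.
  - apply (is_derive_difference (fun x => y x * Dv x) (fun x => v x * Dy x));
      apply is_derive_product; eassumption.
  - field. lra.
Qed.

(** The Wronskian increases strictly as long as both solutions stay positive,
    but at a zero of the slower one [v], reached from above, it is nonpositive. *)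
Lemma sturm_wronskian (Qy y Dy Qv v Dv : R -> R) (lo a b : R) : 0 <= lo ->
  solves Qy y Dy lo -> solves Qv v Dv lo -> lo < a < b ->
  (forall x, a < x < b -> Qv x < Qy x) ->
  (forall x, a < x < b -> 0 < v x) -> (forall x, a < x < b -> 0 < y x) ->
  v b = 0 -> 0 <= y a * Dv a - v a * Dy a -> False.
Proof.
  intros Hlo Hy Hv Hab HQ Hvp Hyp Hvb Hwa.
  assert (Hw : y a * Dv a - v a * Dy a < y b * Dv b - v b * Dy b).
  { apply (strictly_increasing_of_derive (fun x => y x * Dv x - v x * Dy x)
      (fun x => (Qy x - Qv x) * (v x * y x) / x)); [lra | |].
    - intros x Hx. apply (wronskian_derive _ _ _ _ _ _ lo); auto; lra.
    - intros x Hx. specialize (HQ x Hx). specialize (Hvp x Hx). specialize (Hyp x Hx).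
      apply Rdiv_lt_0_compat; [| lra]. repeat apply Rmult_lt_0_compat; lra. }
  assert (Hyb : 0 <= y b).
  { apply (nonneg_at_endpoint y a b); [lra | now right | | exact Hyp].
    apply (solves_continuous Qy y Dy lo); [exact Hy | lra]. }
  assert (Hdv : Dv b / b <= 0).
  { apply (derive_at_right_root v a b); [lra | apply Hv; lra | exact Hvb | exact Hvp]. }
  assert (Hb : Dv b = Dv b / b * b) by (field; lra).
  rewrite Hvb in Hw. assert (y b * Dv b <= 0); [| lra].
  assert (Dv b <= 0) by nra. nra.
Qed.

Lemma sturm_pos (Qy y Dy Qv v Dv : R -> R) (lo a b : R) : 0 <= lo ->
  solves Qy y Dy lo -> solves Qv v Dv lo -> lo < a < b ->
  (forall x, a < x < b -> Qv x < Qy x) ->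
  (forall x, a < x < b -> 0 < v x) -> (forall x, a < x < b -> 0 < y x) ->
  v a = 0 -> v b = 0 -> False.
Proof.
  intros Hlo Hy Hv Hab HQ Hvp Hyp Hva Hvb.
  apply (sturm_wronskian Qy y Dy Qv v Dv lo a b); auto. rewrite Hva.
  assert (0 <= y a).
  { apply (nonneg_at_endpoint y a b); [lra | now left | | exact Hyp].
    apply (solves_continuous Qy y Dy lo); [exact Hy | lra]. }
  assert (0 <= Dv a / a).
  { apply (derive_at_left_root v a b); [lra | apply Hv; lra | exact Hva | exact Hvp]. }
  assert (Hb : Dv a = Dv a / a * a) by (field; lra).
  assert (0 <= Dv a) by nra. nra.
Qed.

(** Sturm's comparison theorem: the larger potential [Qy] makes [y] oscillate faster. *)
Lemma sturm (Qy y Dy Qv v Dv : R -> R) (lo a b : R) : 0 <= lo ->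
  solves Qy y Dy lo -> solves Qv v Dv lo -> lo < a < b ->
  (forall x, a < x < b -> Qv x < Qy x) ->
  v a = 0 -> v b = 0 -> (forall x, a < x < b -> v x <> 0) ->
  exists c, a < c <= b /\ y c = 0.
Proof.
  intros Hlo Hy Hv Hab HQ Hva Hvb Hvn.
  apply NNPP. intro Hno.
  assert (Hyn : forall x, a < x < b -> y x <> 0).
  { intros x Hx H0. apply Hno. exists x. split; [lra | exact H0]. }
  assert (Hyo := solves_opp _ _ _ _ Hy). assert (Hvo := solves_opp _ _ _ _ Hv).
  destruct (nonvanishing_sign v a b) as [Hvs | Hvs]; auto.
  { intros x Hx. apply (solves_continuous Qv v Dv lo); [exact Hv | lra]. }
  - destruct (nonvanishing_sign y a b) as [Hys | Hys]; auto.
    { intros x Hx. apply (solves_continuous Qy y Dy lo); [exact Hy | lra]. }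
    + exact (sturm_pos _ _ _ _ _ _ lo a b Hlo Hy Hv Hab HQ Hvs Hys Hva Hvb).
    + exact (sturm_pos _ _ _ _ _ _ lo a b Hlo Hyo Hv Hab HQ Hvs Hys Hva Hvb).
  - destruct (nonvanishing_sign y a b) as [Hys | Hys]; auto.
    { intros x Hx. apply (solves_continuous Qy y Dy lo); [exact Hy | lra]. }
    + apply (sturm_pos _ _ _ _ _ _ lo a b Hlo Hy Hvo Hab HQ Hvs Hys); lra.
    + apply (sturm_pos _ _ _ _ _ _ lo a b Hlo Hyo Hvo Hab HQ Hvs Hys); lra.
Qed.

(** * Equations with a prescribed phase *)

(** [p], [p1], [p2] are the successive logarithmic derivatives of [psi]. *)
Definition phase (psi p p1 p2 : R -> R) (lo : R) : Prop :=
  forall x, lo < x -> 0 < p x /\ is_derive psi x (p x / x) /\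
    is_derive p x (p1 x / x) /\ is_derive p1 x (p2 x / x).

(** The potential of the equation solved by [sin (psi - c) / sqrt p]: the square
    of [p], corrected by a Schwarzian derivative. *)
Definition phase_potential (p p1 p2 : R -> R) (x : R) : R :=
  p x ^ 2 + p2 x / (2 * p x) - 3 / 4 * (p1 x / p x) ^ 2.

Lemma phase_solves (psi p p1 p2 : R -> R) (lo c : R) : 0 <= lo -> phase psi p p1 p2 lo ->
  solves (phase_potential p p1 p2)
    (fun x => sin (psi x - c) / sqrt (p x))
    (fun x => sqrt (p x) * cos (psi x - c) - p1 x / (2 * p x * sqrt (p x)) * sin (psi x - c))
    lo.
Proof.
  intros Hlo Hph x Hx. destruct (Hph x Hx) as [Hp [H1 [H2 H3]]].
  assert (Hs : 0 < sqrt (p x)) by now apply sqrt_lt_R0.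
  assert (Hss : p x = sqrt (p x) * sqrt (p x)) by (symmetry; apply sqrt_sqrt; lra).
  assert (Hsin : is_derive (fun x => sin (psi x - c)) x (p x / x * cos (psi x - c))).
  { apply (is_derive_compose sin (fun x => psi x - c)).
    - apply is_derive_sin.
    - eapply is_derive_value.
      + apply is_derive_difference; [exact H1 | apply (is_derive_const c)].
      + unfold zero; simpl. ring. }
  assert (Hcos : is_derive (fun x => cos (psi x - c)) x (p x / x * - sin (psi x - c))).
  { apply (is_derive_compose cos (fun x => psi x - c)).
    - apply is_derive_cos.
    - eapply is_derive_value.
      + apply is_derive_difference; [exact H1 | apply (is_derive_const c)].
      + unfold zero; simpl. ring. }
  assert (Hsq := is_derive_sqrt p x _ H2 Hp).
  assert (Hden : is_derive (fun x => 2 * p x * sqrt (p x)) x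
            (2 * (p1 x / x) * sqrt (p x) + 2 * p x * (p1 x / x / (2 * sqrt (p x))))).
  { apply (is_derive_product (fun x => 2 * p x) (fun x => sqrt (p x))); [| exact Hsq].
    apply (is_derive_scal p), H2. }
  assert (Hden0 : 2 * p x * sqrt (p x) <> 0) by (apply Rgt_not_eq; nra).
  split; eapply is_derive_value.
  - apply (is_derive_div (fun x => sin (psi x - c)) (fun x => sqrt (p x)));
      [exact Hsin | exact Hsq | lra].
  - clear - Hx Hlo Hs Hss. revert Hss. generalize (sqrt (p x)) as s, Hs.
    intros s Hs' ->. field. lra.
  - apply (is_derive_difference (fun x => sqrt (p x) * cos (psi x - c))
             (fun x => p1 x / (2 * p x * sqrt (p x)) * sin (psi x - c))).
    + apply is_derive_product; [exact Hsq | exact Hcos].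
    + apply (is_derive_product (fun x => p1 x / (2 * p x * sqrt (p x)))); [| exact Hsin].
      apply (is_derive_div p1 (fun x => 2 * p x * sqrt (p x))); [exact H3 | exact Hden | exact Hden0].
  - unfold phase_potential. clear - Hx Hlo Hs Hss. revert Hss. generalize (sqrt (p x)) as s, Hs.
    intros s Hs' ->. field. lra.
Qed.

Lemma phase_increasing (psi p p1 p2 : R -> R) (lo x y : R) : 0 <= lo ->
  phase psi p p1 p2 lo -> lo < x -> x < y -> psi x < psi y.
Proof.
  intros Hlo Hph Hx Hxy.
  apply (strictly_increasing_of_derive psi (fun t => p t / t)); [exact Hxy | |].
  - intros t Ht. apply Hph. lra.
  - intros t Ht. destruct (Hph t ltac:(lra)) as [Hp _]. apply Rdiv_lt_0_compat; lra.
Qed.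

(** * The two comparison phases *)

(** The logarithmic derivative of [theta_tilde]. *)
Definition phase_speed (nu x : R) : R := sqrt (x ^ 2 - nu ^ 2).

Lemma phase_speed_sqr (nu x : R) : 0 <= nu < x ->
  0 < phase_speed nu x /\ phase_speed nu x ^ 2 = x ^ 2 - nu ^ 2.
Proof.
  intro Hx. assert (0 < x ^ 2 - nu ^ 2) by nra. unfold phase_speed. split.
  - now apply sqrt_lt_R0.
  - rewrite pow2_sqrt; lra.
Qed.

Lemma phase_speed_derive (nu x : R) : 0 <= nu < x ->
  is_derive (phase_speed nu) x (x / phase_speed nu x).
Proof.
  intro Hx. destruct (phase_speed_sqr nu x Hx) as [Hr Hr2].
  unfold phase_speed. eapply is_derive_value.
  - apply (is_derive_sqrt (fun x => x ^ 2 - nu ^ 2)); [| nra].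
    instantiate (1 := 2 * x). auto_derive; [exact I | ring].
  - unfold phase_speed in Hr. field. lra.
Qed.

Lemma phase_speed_compose (nu x l : R) (F : R -> R) : 0 <= nu < x ->
  is_derive F (phase_speed nu x) l ->
  is_derive (fun x => F (phase_speed nu x)) x
    (l * (phase_speed nu x + nu ^ 2 / phase_speed nu x) / x).
Proof.
  intros Hx HF. destruct (phase_speed_sqr nu x Hx) as [Hr Hr2].
  eapply is_derive_value.
  - apply (is_derive_compose F (phase_speed nu)); [exact HF | now apply phase_speed_derive].
  - replace (phase_speed nu x + nu ^ 2 / phase_speed nu x) with (x ^ 2 / phase_speed nu x).
    + field. lra.
    + replace (x ^ 2) with (phase_speed nu x ^ 2 + nu ^ 2) by lra. field. lra.
Qed.

Lemma is_derive_acos (x : R) : -1 < x < 1 -> is_derive acos x (-1 / sqrt (1 - x²)).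
Proof.
  intro Hx. apply is_derive_Reals. rewrite <- (derive_pt_acos x Hx).
  apply (derive_pt_eq_1 acos x _ (derivable_pt_acos x Hx)). reflexivity.
Qed.

Lemma ratio_bounds (nu x : R) : 0 <= nu < x -> 0 <= nu / x < 1.
Proof.
  intro Hx. split.
  - apply Rmult_le_pos; [lra | apply Rlt_le, Rinv_0_lt_compat; lra].
  - apply Rmult_lt_reg_r with x; [lra |]. field_simplify; lra.
Qed.

Lemma sqrt_1_minus_ratio (nu x : R) : 0 <= nu < x ->
  sqrt (1 - (nu / x)²) = phase_speed nu x / x.
Proof.
  intro Hx. unfold phase_speed.
  replace (x ^ 2 - nu ^ 2) with (x * x * (1 - (nu / x)²)) by (unfold Rsqr; field; lra).
  rewrite sqrt_mult_alt, sqrt_square by nra. field. lra.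
Qed.

Lemma theta_tilde_derive (nu x : R) : 0 <= nu < x ->
  is_derive (theta_tilde nu) x (phase_speed nu x / x).
Proof.
  intro Hx. destruct (phase_speed_sqr nu x Hx) as [Hr Hr2].
  assert (Hq := ratio_bounds nu x Hx).
  unfold theta_tilde. eapply is_derive_value.
  - apply (is_derive_difference (fun x => phase_speed nu x - nu * acos (nu / x)) (fun _ => PI / 4));
      [| apply (is_derive_const (PI / 4))].
    apply (is_derive_difference (phase_speed nu) (fun x => nu * acos (nu / x)));
      [now apply phase_speed_derive |].
    apply (is_derive_scal (fun x => acos (nu / x))).
    apply (is_derive_compose acos (fun x => nu / x)); [apply is_derive_acos; lra |].
    instantiate (1 := - nu / x ^ 2). auto_derive; [lra | field; lra].
  - unfold zero; simpl. rewrite sqrt_1_minus_ratio by exact Hx.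
    replace (x / phase_speed nu x)
      with ((phase_speed nu x ^ 2 + nu ^ 2) / (x * phase_speed nu x)).
    + field. lra.
    + rewrite Hr2. field. lra.
Qed.

(** The amount subtracted in [theta_under], in the variable in which the derivatives
    below are rational. *)
Definition theta_correction (nu x : R) : R :=
  / (8 * phase_speed nu x) + 5 * nu ^ 2 / (24 * phase_speed nu x ^ 3).

Lemma theta_under_correction (nu x : R) : 0 <= nu < x ->
  theta_under nu x = theta_tilde nu x - theta_correction nu x.
Proof.
  intro Hx. destruct (phase_speed_sqr nu x Hx) as [Hr Hr2].
  unfold theta_under, theta_correction. f_equal.
  replace (3 / 2) with (1 + / 2) by field.
  rewrite Rpower_plus, Rpower_1, Rpower_sqrt by nra. fold (phase_speed nu x).
  rewrite <- Hr2. replace (3 * x ^ 2 + 2 * nu ^ 2) with (3 * phase_speed nu x ^ 2 + 5 * nu ^ 2) by lra.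
  field. lra.
Qed.

Lemma theta_correction_pos (nu x : R) : 0 <= nu < x -> 0 < theta_correction nu x.
Proof.
  intro Hx. destruct (phase_speed_sqr nu x Hx) as [Hr Hr2]. unfold theta_correction.
  assert (0 < / (8 * phase_speed nu x)) by (apply Rinv_0_lt_compat; lra).
  assert (0 <= 5 * nu ^ 2 / (24 * phase_speed nu x ^ 3)); [| lra].
  apply Rmult_le_pos; [nra |]. apply Rlt_le, Rinv_0_lt_compat.
  assert (0 < phase_speed nu x ^ 3) by now apply pow_lt. lra.
Qed.

Definition tilde_p1 (nu r : R) : R := r + nu ^ 2 / r.
Definition tilde_p2 (nu r : R) : R := r - nu ^ 4 / r ^ 3.

Lemma theta_tilde_phase (nu : R) : 0 <= nu ->
  phase (theta_tilde nu) (phase_speed nu)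
    (fun x => tilde_p1 nu (phase_speed nu x)) (fun x => tilde_p2 nu (phase_speed nu x)) nu.
Proof.
  intros Hnu x Hx0. assert (Hx : 0 <= nu < x) by lra.
  destruct (phase_speed_sqr nu x Hx) as [Hr Hr2].
  split; [exact Hr | split; [now apply theta_tilde_derive | split]]; eapply is_derive_value.
  - apply (phase_speed_compose nu x 1 (fun r => r) Hx), (is_derive_id (K := R_AbsRing)).
  - unfold tilde_p1. f_equal. ring.
  - apply (phase_speed_compose nu x (1 - nu ^ 2 / phase_speed nu x ^ 2) (tilde_p1 nu) Hx).
    unfold tilde_p1. auto_derive; [lra | field; lra].
  - unfold tilde_p2. field. lra.
Qed.

(** The Schwarzian correction of the WKB phase is negative. *)
Lemma theta_tilde_slower (nu x : R) : 0 <= nu < x ->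
  phase_potential (phase_speed nu) (fun x => tilde_p1 nu (phase_speed nu x))
    (fun x => tilde_p2 nu (phase_speed nu x)) x < x ^ 2 - nu ^ 2.
Proof.
  intro Hx. destruct (phase_speed_sqr nu x Hx) as [Hr Hr2].
  unfold phase_potential, tilde_p1, tilde_p2. rewrite <- Hr2.
  generalize dependent (phase_speed nu x). intros r Hr _.
  assert (H : 0 < / 4 + 3 * nu ^ 2 / (2 * r ^ 2) + 5 * nu ^ 4 / (4 * r ^ 4)).
  { assert (0 < r ^ 2) by now apply pow_lt. assert (0 < r ^ 4) by now apply pow_lt.
    assert (0 <= nu ^ 4) by (apply pow_le; lra).
    assert (0 <= 3 * nu ^ 2 / (2 * r ^ 2))
      by (apply Rmult_le_pos; [nra | apply Rlt_le, Rinv_0_lt_compat; lra]).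
    assert (0 <= 5 * nu ^ 4 / (4 * r ^ 4))
      by (apply Rmult_le_pos; [lra | apply Rlt_le, Rinv_0_lt_compat; lra]).
    lra. }
  apply Rlt_0_minus. eapply Rlt_le_trans; [exact H |]. right. field. lra.
Qed.

(** With [q] the relative defect of the WKB potential, [under_p] is [r (1 + q / 2)]. *)
Definition under_p (nu r : R) : R :=
  r + / (8 * r) + 3 * nu ^ 2 / (4 * r ^ 3) + 5 * nu ^ 4 / (8 * r ^ 5).
Definition under_p1 (nu r : R) : R :=
  r + (nu ^ 2 - / 8) / r - 19 * nu ^ 2 / (8 * r ^ 3) - 43 * nu ^ 4 / (8 * r ^ 5)
  - 25 * nu ^ 6 / (8 * r ^ 7).
Definition under_p2 (nu r : R) : R :=
  r + / (8 * r) + (29 * nu ^ 2 / 4 - nu ^ 4) / r ^ 3 + 34 * nu ^ 4 / r ^ 5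
  + 195 * nu ^ 6 / (4 * r ^ 7) + 175 * nu ^ 8 / (8 * r ^ 9).

Lemma under_p_pos (nu r : R) : 0 <= nu -> 0 < r -> 0 < under_p nu r.
Proof.
  intros Hnu Hr. unfold under_p.
  assert (0 <= nu ^ 2) by now apply pow_le. assert (0 <= nu ^ 4) by now apply pow_le.
  assert (0 < r ^ 3) by now apply pow_lt. assert (0 < r ^ 5) by now apply pow_lt.
  assert (0 < / (8 * r)) by (apply Rinv_0_lt_compat; lra).
  assert (0 <= 3 * nu ^ 2 / (4 * r ^ 3))
    by (apply Rmult_le_pos; [lra | apply Rlt_le, Rinv_0_lt_compat; lra]).
  assert (0 <= 5 * nu ^ 4 / (8 * r ^ 5))
    by (apply Rmult_le_pos; [lra | apply Rlt_le, Rinv_0_lt_compat; lra]).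
  lra.
Qed.

Lemma theta_under_phase (nu : R) : 0 <= nu ->
  phase (theta_under nu) (fun x => under_p nu (phase_speed nu x))
    (fun x => under_p1 nu (phase_speed nu x)) (fun x => under_p2 nu (phase_speed nu x)) nu.
Proof.
  intros Hnu x Hx0. assert (Hx : 0 <= nu < x) by lra.
  destruct (phase_speed_sqr nu x Hx) as [Hr Hr2].
  assert (H0 : phase_speed nu x <> 0) by lra.
  split; [now apply under_p_pos | split; [| split]].
  - apply (is_derive_ext_loc (fun x => theta_tilde nu x - theta_correction nu x)).
    { apply (filter_imp (fun y => nu < y)); [| now apply locally_gt].
      intros y Hy. symmetry. apply theta_under_correction. lra. }
    eapply is_derive_value.
    + apply is_derive_difference; [now apply theta_tilde_derive |].
      apply (phase_speed_compose nu x
        (- / (8 * phase_speed nu x ^ 2) - 5 * nu ^ 2 / (8 * phase_speed nu x ^ 4))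
        (fun r => / (8 * r) + 5 * nu ^ 2 / (24 * r ^ 3)) Hx).
      auto_derive; [repeat split; try lra; apply Rmult_integral_contrapositive_currified; try lra;
        now apply (pow_nonzero _ 3) | field; lra].
    + unfold under_p. field. lra.
  - eapply is_derive_value.
    + apply (phase_speed_compose nu x
        (1 - / (8 * phase_speed nu x ^ 2) - 9 * nu ^ 2 / (4 * phase_speed nu x ^ 4)
         - 25 * nu ^ 4 / (8 * phase_speed nu x ^ 6)) (under_p nu) Hx).
      unfold under_p.
      auto_derive; [repeat split; try lra; apply Rmult_integral_contrapositive_currified; try lra;
        first [now apply (pow_nonzero _ 3) | now apply (pow_nonzero _ 5)] | field; lra].
    + unfold under_p1. field. lra.
  - eapply is_derive_value.
    + apply (phase_speed_compose nu x
        (1 - (nu ^ 2 - / 8) / phase_speed nu x ^ 2 + 57 * nu ^ 2 / (8 * phase_speed nu x ^ 4)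
         + 215 * nu ^ 4 / (8 * phase_speed nu x ^ 6) + 175 * nu ^ 6 / (8 * phase_speed nu x ^ 8))
        (under_p1 nu) Hx).
      unfold under_p1.
      auto_derive; [repeat split; try lra; apply Rmult_integral_contrapositive_currified; try lra;
        first [now apply (pow_nonzero _ 3) | now apply (pow_nonzero _ 5)
              | now apply (pow_nonzero _ 7)] | field; lra].
    + unfold under_p2. field. lra.
Qed.

(** Over a common denominator the excess of the potential is a polynomial in [nu]
    and [r] all of whose coefficients are positive. *)
Definition under_excess (nu r : R) : R :=
  (1600 * r ^ 20 + 16 * r ^ 18 + 1 * r ^ 16)
   + nu ^ 2 * (35584 * r ^ 18 + 800 * r ^ 16 + 24 * r ^ 14)
   + nu ^ 4 * (132992 * r ^ 16 + 2480 * r ^ 14 + 236 * r ^ 12)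
   + nu ^ 6 * (169728 * r ^ 14 + 5824 * r ^ 12 + 1224 * r ^ 10)
   + nu ^ 8 * (70720 * r ^ 12 + 9328 * r ^ 10 + 3606 * r ^ 8)
   + nu ^ 10 * (7200 * r ^ 8 + 6120 * r ^ 6)
   + nu ^ 12 * (2000 * r ^ 6 + 5900 * r ^ 4)
   + nu ^ 14 * (3000 * r ^ 2)
   + nu ^ 16 * (625).

Lemma under_excess_pos (nu r : R) : 0 <= nu -> 0 < r -> 0 < under_excess nu r.
Proof.
  intros Hnu Hr.
  assert (Hp : forall k, 0 < r ^ k) by (intro k; now apply pow_lt).
  assert (Hn : forall k, 0 <= nu ^ k) by (intro k; now apply pow_le).
  assert (Hc : forall c k, 0 < c -> 0 < c * r ^ k)
    by (intros c k Hc; now apply Rmult_lt_0_compat).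
  unfold under_excess.
  apply Rplus_lt_le_0_compat; [repeat apply Rplus_lt_le_0_compat |].
  all: try (apply Rmult_le_pos; [apply Hn |]; apply Rlt_le).
  all: repeat match goal with |- 0 < _ + _ => apply Rplus_lt_0_compat end.
  all: first [lra | try apply Rlt_le; apply Hc; lra].
Qed.

Lemma theta_under_faster (nu x : R) : 0 <= nu < x ->
  x ^ 2 - nu ^ 2 < phase_potential (fun x => under_p nu (phase_speed nu x))
    (fun x => under_p1 nu (phase_speed nu x)) (fun x => under_p2 nu (phase_speed nu x)) x.
Proof.
  intro Hx. destruct (phase_speed_sqr nu x Hx) as [Hr Hr2].
  unfold phase_potential. rewrite <- Hr2.
  generalize dependent (phase_speed nu x). intros r Hr _.
  assert (Hp := under_p_pos nu r (proj1 Hx) Hr).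
  assert (H : 0 < under_excess nu r / (4096 * r ^ 20 * under_p nu r ^ 2)).
  { apply Rdiv_lt_0_compat; [apply under_excess_pos; lra |].
    repeat apply Rmult_lt_0_compat; try apply pow_lt; lra. }
  apply Rlt_0_minus. eapply Rlt_le_trans; [exact H |]. right.
  assert (E : 4096 * r ^ 20 * (under_p nu r ^ 4 + under_p nu r * under_p2 nu r / 2
      - 3 / 4 * under_p1 nu r ^ 2 - r ^ 2 * under_p nu r ^ 2) = under_excess nu r).
  { unfold under_p, under_p1, under_p2, under_excess. field. lra. }
  rewrite <- E. field. lra.
Qed.

(** * The zeros of the Bessel function *)

Lemma phase_speed_ge (nu x : R) : 0 <= nu < x -> x - nu <= phase_speed nu x <= x.
Proof.
  intro Hx. destruct (phase_speed_sqr nu x Hx) as [Hr Hr2]. nra.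
Qed.

Lemma theta_tilde_unbounded (nu x : R) : 0 <= nu < x ->
  x - nu - nu * PI - PI / 4 <= theta_tilde nu x.
Proof.
  intro Hx. destruct (phase_speed_ge nu x Hx) as [H1 H2].
  destruct (acos_bound (nu / x)) as [H3 H4].
  unfold theta_tilde. fold (phase_speed nu x). nra.
Qed.

Lemma theta_tilde_le (nu x : R) : 0 <= nu < x -> theta_tilde nu x <= x.
Proof.
  intro Hx. destruct (phase_speed_ge nu x Hx) as [H1 H2].
  destruct (acos_bound (nu / x)) as [H3 H4]. pose proof PI_RGT_0.
  unfold theta_tilde. fold (phase_speed nu x). nra.
Qed.

Lemma theta_tilde_increasing (nu x y : R) : 0 <= nu < x -> x <= y ->
  theta_tilde nu x <= theta_tilde nu y.
Proof.
  intros Hx [Hxy | ->]; [| lra]. apply Rlt_le.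
  apply (phase_increasing _ _ _ _ nu x y (proj1 Hx) (theta_tilde_phase nu (proj1 Hx))); lra.
Qed.

Lemma theta_under_increasing (nu x y : R) : 0 <= nu < x -> x < y ->
  theta_under nu x < theta_under nu y.
Proof.
  intros Hx Hxy.
  apply (phase_increasing _ _ _ _ nu x y (proj1 Hx) (theta_under_phase nu (proj1 Hx))); lra.
Qed.

Lemma theta_tilde_attains (nu a t : R) : 0 <= nu < a -> theta_tilde nu a < t ->
  exists b, a < b /\ theta_tilde nu b = t.
Proof.
  intros Ha Ht. pose proof PI_RGT_0.
  destruct (first_root_pos (fun x => t - theta_tilde nu x) a
              (Rmax (a + 1) (t + nu + nu * PI + PI / 4))) as [b [Hb [H0 _]]].
  - apply Rlt_le_trans with (a + 1); [lra | apply Rmax_l].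
  - intros x Hx. apply (continuous_minus (fun _ => t) (theta_tilde nu)).
    + apply continuous_const.
    + eapply derive_continuous. apply theta_tilde_derive. lra.
  - lra.
  - set (m := Rmax _ _).
    assert (a + 1 <= m) by apply Rmax_l.
    assert (t + nu + nu * PI + PI / 4 <= m) by apply Rmax_r.
    pose proof (theta_tilde_unbounded nu m ltac:(lra)). lra.
  - exists b. split; lra.
Qed.

Lemma BesselJ_solves_barrier (nu : R) : 0 <= nu ->
  solves (fun x => x ^ 2 - nu ^ 2) (BesselJ nu) (BesselJ' nu) nu.
Proof. intro Hnu. apply (solves_weaken _ _ _ 0 nu Hnu), BesselJ_solves, Hnu. Qed.

(** The sine built on [theta_tilde] and vanishing at [a] is slower than [J_nu]. *)
Lemma BesselJ_zero_in_gap (nu a b : R) : 0 <= nu < a -> a < b ->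
  theta_tilde nu b = theta_tilde nu a + PI -> exists c, a < c <= b /\ BesselJ nu c = 0.
Proof.
  intros Ha Hab Hb. pose proof PI_RGT_0.
  assert (Hnu : 0 <= nu) by lra.
  assert (Hph := theta_tilde_phase nu Hnu).
  apply (sturm _ _ _ _ _ _ nu a b Hnu (BesselJ_solves_barrier nu Hnu)
           (phase_solves _ _ _ _ nu (theta_tilde nu a) Hnu Hph)).
  - lra.
  - intros x Hx. apply theta_tilde_slower. lra.
  - rewrite Rminus_diag, sin_0. apply Rdiv_0_l.
  - rewrite Hb. replace (theta_tilde nu a + PI - theta_tilde nu a) with PI by ring.
    rewrite sin_PI. apply Rdiv_0_l.
  - intros x Hx.
    assert (theta_tilde nu a < theta_tilde nu x < theta_tilde nu b).
    { split; apply (phase_increasing _ _ _ _ nu _ _ Hnu Hph); lra. }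
    apply Rmult_integral_contrapositive_currified.
    + apply Rgt_not_eq, sin_gt_0; lra.
    + apply Rinv_neq_0_compat, Rgt_not_eq, sqrt_lt_R0, (Hph x ltac:(lra)).
Qed.

Definition next_zero (nu z z' : R) : Prop :=
  z < z' /\ BesselJ nu z' = 0 /\ forall x, z < x < z' -> BesselJ nu x <> 0.

Lemma BesselJ_zero_gt (nu x : R) : 0 < x -> BesselJ nu x = 0 -> nu < x.
Proof.
  intros Hx H0. apply Rnot_le_lt. intro Hle.
  pose proof (BesselJ_pos_barrier nu x ltac:(lra)). lra.
Qed.

Lemma tilde_gap_le (nu z z' : R) : 0 <= nu < z -> next_zero nu z z' ->
  theta_tilde nu z' <= theta_tilde nu z + PI.
Proof.
  intros Hz [Hzz [_ Hno]]. pose proof PI_RGT_0.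
  destruct (theta_tilde_attains nu z (theta_tilde nu z + PI) Hz ltac:(lra)) as [b [Hb Eb]].
  destruct (BesselJ_zero_in_gap nu z b Hz Hb Eb) as [c [Hc H0]].
  rewrite <- Eb. apply theta_tilde_increasing; [lra |].
  apply Rnot_lt_le. intro Hlt. apply (Hno c); [lra | exact H0].
Qed.

(** The sine built on [theta_under] and vanishing at [z] is faster than [J_nu], so it
    vanishes again no later than at [z']. *)
Lemma under_gap_ge (nu z z' : R) : 0 <= nu < z -> BesselJ nu z = 0 -> next_zero nu z z' ->
  theta_under nu z + PI <= theta_under nu z'.
Proof.
  intros Hz Hz0 [Hzz [Hz1 Hno]]. pose proof PI_RGT_0.
  assert (Hnu : 0 <= nu) by lra.
  assert (Hph := theta_under_phase nu Hnu).
  destruct (sturm _ _ _ _ _ _ nu z z' Hnu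
              (phase_solves _ _ _ _ nu (theta_under nu z) Hnu Hph)
              (BesselJ_solves_barrier nu Hnu)) as [c [Hc H0]]; auto.
  - lra.
  - intros x Hx. apply theta_under_faster. lra.
  - cbv beta in H0.
    assert (Hs : sin (theta_under nu c - theta_under nu z) = 0).
    { apply Rmult_integral in H0. destruct H0 as [H0 | H0]; [exact H0 |].
      exfalso. revert H0.
      apply Rinv_neq_0_compat, Rgt_not_eq, sqrt_lt_R0, (Hph c ltac:(lra)). }
    assert (theta_under nu z < theta_under nu c) by (apply theta_under_increasing; lra).
    assert (theta_under nu c <= theta_under nu z').
    { destruct (proj2 Hc) as [H2 | ->]; [| lra].
      apply Rlt_le, theta_under_increasing; lra. }
    assert (PI <= theta_under nu c - theta_under nu z); [| lra].
    apply Rnot_lt_le. intro Hlt.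
    pose proof (sin_gt_0 (theta_under nu c - theta_under nu z) ltac:(lra) Hlt). lra.
Qed.

Lemma BesselJ_zero_isolated (nu z : R) : 0 <= nu -> 0 <= z -> (z = 0 \/ BesselJ nu z = 0) ->
  exists d, 0 < d /\ forall x, z < x < z + d -> BesselJ nu x <> 0.
Proof.
  intros Hnu Hz0 Hz. destruct (Rle_lt_or_eq_dec 0 z Hz0) as [Hp | <-].
  - assert (H0 : BesselJ nu z = 0) by (destruct Hz; [lra | assumption]).
    assert (Hd := BesselJ_derive nu z Hnu Hp). rewrite H0 in Hd.
    destruct (Rtotal_order (BesselJ (nu + 1) z) 0) as [H | [H | H]].
    + destruct (derive_pos_crossing _ z _ Hd ltac:(lra) H0) as [d [Hd0 [_ Hr]]].
      exists d. split; [exact Hd0 |]. intros x Hx. specialize (Hr x Hx). lra.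
    + exfalso. exact (BesselJ_no_common_zero nu z Hnu Hp H0 H).
    + destruct (derive_pos_crossing (fun x => - BesselJ nu x) z
                  (- (nu / z * 0 - BesselJ (nu + 1) z))) as [d [Hd0 [_ Hr]]]; try lra.
      { apply (is_derive_opp (BesselJ nu)), Hd. }
      exists d. split; [exact Hd0 |]. intros x Hx. specialize (Hr x Hx). lra.
  - destruct (BesselJ_pos_near_0 nu Hnu) as [d [Hd Hpos]].
    exists d. split; [exact Hd |]. intros x Hx. apply Rgt_not_eq, Hpos. lra.
Qed.

Lemma next_zero_exists (nu z : R) : 0 <= nu -> 0 <= z -> (z = 0 \/ BesselJ nu z = 0) ->
  exists z', next_zero nu z z'.
Proof.
  intros Hnu Hz0 Hz. pose proof PI_RGT_0.
  destruct (BesselJ_zero_isolated nu z Hnu Hz0 Hz) as [d [Hd Hiso]].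
  set (a := Rmax (z + d / 2) (nu + 1)).
  assert (Ha1 : z + d / 2 <= a) by apply Rmax_l. assert (Ha2 : nu + 1 <= a) by apply Rmax_r.
  destruct (theta_tilde_attains nu a (theta_tilde nu a + PI) ltac:(lra) ltac:(lra)) as [b [Hb Eb]].
  destruct (BesselJ_zero_in_gap nu a b ltac:(lra) Hb Eb) as [c [Hc H0]].
  destruct (first_root (BesselJ nu) (z + d / 2) c) as [z' [Hz' [Hz'0 Hno]]].
  - lra.
  - intros x Hx. apply BesselJ_continuous; lra.
  - apply Hiso. lra.
  - exact H0.
  - exists z'. repeat split; [lra | exact Hz'0 |]. intros x Hx.
    destruct (Rlt_le_dec x (z + d / 2)); [apply Hiso | apply Hno]; lra.
Qed.

(** The [k]-th positive zero; the value at [k = 0] is the origin, from which the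
    first zero is the next one. *)
Definition bessel_zero (nu : R) (k : nat) : R :=
  Nat.iter k (fun z => epsilon (inhabits 0) (next_zero nu z)) 0.

Lemma bessel_zero_next (nu : R) (k : nat) : 0 <= nu ->
  next_zero nu (bessel_zero nu k) (bessel_zero nu (S k)).
Proof.
  intro Hnu.
  assert (Hgood : forall z, 0 <= z -> (z = 0 \/ BesselJ nu z = 0) ->
            next_zero nu z (epsilon (inhabits 0) (next_zero nu z))).
  { intros z H1 H2. apply epsilon_spec, next_zero_exists; assumption. }
  enough (H : 0 <= bessel_zero nu k /\ (bessel_zero nu k = 0 \/ BesselJ nu (bessel_zero nu k) = 0))
    by (apply Hgood; apply H).
  induction k as [| k [IH1 IH2]].
  - split; [apply Rle_refl | now left].
  - destruct (Hgood _ IH1 IH2) as [H1 [H2 _]].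
    change (epsilon _ _) with (bessel_zero nu (S k)) in H1, H2. split; [lra | now right].
Qed.

Lemma bessel_zero_lt_succ (nu : R) (k : nat) : 0 <= nu -> bessel_zero nu k < bessel_zero nu (S k).
Proof. intro Hnu. apply (bessel_zero_next nu k Hnu). Qed.

Lemma bessel_zero_root (nu : R) (k : nat) : 0 <= nu -> BesselJ nu (bessel_zero nu (S k)) = 0.
Proof. intro Hnu. apply (bessel_zero_next nu k Hnu). Qed.

Lemma bessel_zero_increasing (nu : R) (m n : nat) : 0 <= nu -> (m < n)%nat ->
  bessel_zero nu m < bessel_zero nu n.
Proof.
  intros Hnu Hmn. induction Hmn as [| n Hmn IH].
  - now apply bessel_zero_lt_succ.
  - pose proof (bessel_zero_lt_succ nu n Hnu). lra.
Qed.

Lemma bessel_zero_nonneg (nu : R) (k : nat) : 0 <= nu -> 0 <= bessel_zero nu k.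
Proof.
  intro Hnu. destruct k as [| k]; [apply Rle_refl |].
  apply Rlt_le, (bessel_zero_increasing nu 0 (S k) Hnu). lia.
Qed.

Lemma bessel_zero_pos (nu : R) (k : nat) : 0 <= nu -> 0 < bessel_zero nu (S k).
Proof.
  intro Hnu. pose proof (bessel_zero_nonneg nu k Hnu). pose proof (bessel_zero_lt_succ nu k Hnu). lra.
Qed.

Lemma bessel_zero_gt (nu : R) (k : nat) : 0 <= nu -> nu < bessel_zero nu (S k).
Proof.
  intro Hnu. apply BesselJ_zero_gt; [now apply bessel_zero_pos | now apply bessel_zero_root].
Qed.

Lemma bessel_zero_le_root (nu x : R) (k : nat) : 0 <= nu -> bessel_zero nu k < x ->
  BesselJ nu x = 0 -> bessel_zero nu (S k) <= x.
Proof.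
  intros Hnu Hx H0. destruct (bessel_zero_next nu k Hnu) as [_ [_ Hno]].
  apply Rnot_lt_le. intro Hlt. apply (Hno x); [lra | exact H0].
Qed.

Lemma theta_under_zero_growth (nu : R) (k : nat) : 0 <= nu ->
  theta_under nu (bessel_zero nu 1) + PI * INR k <= theta_under nu (bessel_zero nu (S k)).
Proof.
  intro Hnu. induction k as [| k IH]; [simpl; lra |].
  pose proof (under_gap_ge nu _ _ (conj Hnu (bessel_zero_gt nu k Hnu)) (bessel_zero_root nu k Hnu)
                (bessel_zero_next nu (S k) Hnu)).
  rewrite S_INR. lra.
Qed.

Lemma bessel_zero_lim (nu : R) : 0 <= nu -> is_lim_seq (fun k => bessel_zero nu (S k)) p_infty.
Proof.
  intro Hnu. pose proof PI_RGT_0.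
  apply (is_lim_seq_le_p_loc (fun k => theta_under nu (bessel_zero nu 1) + PI * INR k)).
  - exists 0%nat. intros k _.
    pose proof (theta_under_zero_growth nu k Hnu).
    assert (Hb : 0 <= nu < bessel_zero nu (S k)) by (split; [exact Hnu | now apply bessel_zero_gt]).
    pose proof (theta_under_correction nu _ Hb). pose proof (theta_correction_pos nu _ Hb).
    pose proof (theta_tilde_le nu _ Hb). lra.
  - eapply is_lim_seq_plus.
    + apply is_lim_seq_const.
    + apply is_lim_seq_scal_l. apply is_lim_seq_INR.
    + unfold is_Rbar_plus, Rbar_plus'. simpl. destruct (Rle_dec 0 PI) as [Hle | Hn]; [| lra].
      destruct (Rle_lt_or_eq_dec 0 PI Hle); [reflexivity | lra].
Qed.

Lemma bessel_zero_all (nu x : R) : 0 <= nu -> 0 < x -> BesselJ nu x = 0 ->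
  exists k, x = bessel_zero nu (S k).
Proof.
  intros Hnu Hx H0.
  assert (Hex : exists k, x <= bessel_zero nu k).
  { destruct (bessel_zero_lim nu Hnu (fun y => x < y)) as [N HN].
    - exists x. auto.
    - exists (S N). apply Rlt_le, HN, Nat.le_refl. }
  destruct Hex as [k Hk]. induction k as [| k IH].
  - change (bessel_zero nu 0) with 0 in Hk. lra.
  - destruct (Rlt_le_dec (bessel_zero nu k) x) as [Hlt | Hle]; [| now apply IH].
    exists k. apply Rle_antisym; [exact Hk | now apply bessel_zero_le_root].
Qed.

(** * The phase constant *)

(** The phase of [J_nu], normalised to equal [PI k - PI / 2] at the [k]-th zero, lies
    between [theta_under nu - c - PI / 2] and [theta_tilde nu - c - PI / 2]; this is
    stated at the zeros only. *)
Definition phase_constant (nu c : R) : Prop := forall k : nat,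
  theta_under nu (bessel_zero nu (S k)) <= PI * INR (S k) + c
    <= theta_tilde nu (bessel_zero nu (S k)).

Lemma nested_intervals (w u : nat -> R) : (forall k, w k <= w (S k)) ->
  (forall k, u (S k) <= u k) -> (forall k, w k <= u k) -> exists c, forall k, w k <= c <= u k.
Proof.
  intros Hw Hu Hwu.
  assert (Hwm : forall m n, (m <= n)%nat -> w m <= w n).
  { intros m n H. induction H as [| n H IH]; [lra | specialize (Hw n); lra]. }
  assert (Hum : forall m n, (m <= n)%nat -> u n <= u m).
  { intros m n H. induction H as [| n H IH]; [lra | specialize (Hu n); lra]. }
  assert (Hall : forall m n, w m <= u n).
  { intros m n. specialize (Hwm m _ (Nat.le_max_l m n)). specialize (Hum n _ (Nat.le_max_r m n)).
    specialize (Hwu (Nat.max m n)). lra. }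
  destruct (completeness (fun x => exists k, x = w k)) as [c [Hub Hlub]].
  - exists (u 0%nat). intros x [k ->]. apply Hall.
  - exists (w 0%nat), 0%nat. reflexivity.
  - exists c. intro k. split.
    + apply Hub. now exists k.
    + apply Hlub. intros x [m ->]. apply Hall.
Qed.

(** [theta_under - PI k] increases and [theta_tilde - PI k] decreases along the zeros. *)
Lemma phase_constant_exists (nu : R) : 0 <= nu -> exists c, phase_constant nu c.
Proof.
  intro Hnu.
  destruct (nested_intervals
    (fun k => theta_under nu (bessel_zero nu (S k)) - PI * INR (S k))
    (fun k => theta_tilde nu (bessel_zero nu (S k)) - PI * INR (S k))) as [c Hc].
  - intro k. rewrite (S_INR (S k)).
    pose proof (under_gap_ge nu _ _ (conj Hnu (bessel_zero_gt nu k Hnu)) (bessel_zero_root nu k Hnu)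
                  (bessel_zero_next nu (S k) Hnu)). lra.
  - intro k. rewrite (S_INR (S k)).
    pose proof (tilde_gap_le nu _ _ (conj Hnu (bessel_zero_gt nu k Hnu))
                  (bessel_zero_next nu (S k) Hnu)). lra.
  - intro k. assert (Hb := conj Hnu (bessel_zero_gt nu k Hnu)).
    pose proof (theta_under_correction nu _ Hb). pose proof (theta_correction_pos nu _ Hb). lra.
  - exists c. intro k. specialize (Hc k). lra.
Qed.

Lemma theta_correction_le (nu x : R) : 0 <= nu -> nu + 1 <= x ->
  theta_correction nu x <= (1 + nu ^ 2) / (x - nu).
Proof.
  intros Hnu Hx. assert (Hx' : 0 <= nu < x) by lra.
  destruct (phase_speed_ge nu x Hx') as [H1 H2].
  unfold theta_correction. set (r := phase_speed nu x) in *.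
  assert (Hr : 1 <= r) by lra.
  assert (Hn : 0 <= nu ^ 2) by apply pow2_ge_0.
  assert (Hr3 : r <= r ^ 3) by nra.
  assert (A : / (8 * r) <= / r) by (apply Rinv_le_contravar; lra).
  assert (B : 5 * nu ^ 2 / (24 * r ^ 3) <= nu ^ 2 * / r).
  { apply Rle_trans with (nu ^ 2 * (5 * / (24 * r ^ 3))); [right; field; lra |].
    apply Rmult_le_compat_l; [exact Hn |].
    apply Rle_trans with (5 * / (24 * r)).
    - apply Rmult_le_compat_l; [lra |]. apply Rinv_le_contravar; lra.
    - apply Rmult_le_reg_r with r; [lra |]. field_simplify; lra. }
  assert (C : / r <= / (x - nu)) by (apply Rinv_le_contravar; lra).
  unfold Rdiv at 2. nra.
Qed.

Lemma is_lim_inv_shift (K a : R) : is_lim (fun x => K / (x - a)) p_infty 0.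
Proof.
  unfold Rdiv. replace 0 with (K * 0) by ring.
  apply (is_lim_scal_l (fun x => / (x - a)) K p_infty 0).
  apply (is_lim_inv (fun x => x - a) p_infty p_infty); [| discriminate].
  eapply is_lim_minus; [apply is_lim_id | apply is_lim_const | reflexivity].
Qed.

Lemma theta_correction_lim (nu : R) : 0 <= nu -> is_lim (theta_correction nu) p_infty 0.
Proof.
  intro Hnu.
  apply (is_lim_le_le_loc (fun _ => 0) (fun x => (1 + nu ^ 2) / (x - nu))).
  - exists (nu + 1). intros x Hx. split.
    + apply Rlt_le, theta_correction_pos. lra.
    + apply theta_correction_le; lra.
  - apply is_lim_const.
  - apply is_lim_inv_shift.
Qed.

Lemma theta_tilde_asymptotic (nu : R) : 0 <= nu ->
  is_lim (fun x => x - theta_tilde nu x) p_infty (nu * PI / 2 + PI / 4).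
Proof.
  intro Hnu.
  apply (is_lim_ext_loc (fun x => (x - phase_speed nu x) + (nu * acos (nu / x) + PI / 4))).
  { exists 0. intros x _. unfold theta_tilde. fold (phase_speed nu x). ring. }
  replace (nu * PI / 2 + PI / 4) with (0 + (nu * acos 0 + PI / 4)) by (rewrite acos_0; field).
  apply is_lim_plus'.
  - apply (is_lim_le_le_loc (fun _ => 0) (fun x => nu ^ 2 / (x - 0))).
    + exists nu. intros x Hx. destruct (phase_speed_sqr nu x ltac:(lra)) as [Hr Hr2].
      destruct (phase_speed_ge nu x ltac:(lra)) as [H1 H2]. split; [lra |].
      apply Rmult_le_reg_r with x; [lra |].
      replace (nu ^ 2 / (x - 0) * x) with (nu ^ 2) by (field; lra). nra.
    + apply is_lim_const.
    + apply is_lim_inv_shift.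
  - apply is_lim_plus'; [| apply is_lim_const].
    apply (is_lim_scal_l (fun x => acos (nu / x)) nu p_infty (acos 0)).
    apply (is_lim_comp_continuous (fun x => nu / x) acos p_infty 0).
    + apply (is_lim_ext (fun x => nu / (x - 0))); [intro x; now rewrite Rminus_0_r |].
      apply is_lim_inv_shift.
    + eapply derive_continuous. apply is_derive_acos. lra.
Qed.

(** In particular the phase constant is determined by the zeros. *)
Lemma bessel_zero_asymptotic (nu c : R) : 0 <= nu -> phase_constant nu c ->
  is_lim_seq (fun k => bessel_zero nu (S k) - PI * INR (S k)) (nu * PI / 2 + PI / 4 + c).
Proof.
  intros Hnu Hc.
  assert (Hcomp : forall f l, is_lim f p_infty l ->
            is_lim_seq (fun k => f (bessel_zero nu (S k))) l).
  { intros f l Hf. apply (is_lim_comp_seq f _ p_infty l Hf).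
    - exists 0%nat. intros; discriminate.
    - now apply bessel_zero_lim. }
  apply (is_lim_seq_ext (fun k => (bessel_zero nu (S k) - theta_tilde nu (bessel_zero nu (S k)))
           + (theta_tilde nu (bessel_zero nu (S k)) - PI * INR (S k)))); [intro k; ring |].
  apply is_lim_seq_plus'.
  - apply (Hcomp (fun x => x - theta_tilde nu x)). now apply theta_tilde_asymptotic.
  - apply (is_lim_seq_le_le (fun _ => c) _
             (fun k => c + theta_correction nu (bessel_zero nu (S k)))).
    + intro k. specialize (Hc k).
      rewrite (theta_under_correction nu _ (conj Hnu (bessel_zero_gt nu k Hnu))) in Hc. lra.
    + apply is_lim_seq_const.
    + replace (Finite c) with (Finite (c + 0)) by (f_equal; ring).
      apply is_lim_seq_plus'; [apply is_lim_seq_const |].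
      apply Hcomp. now apply theta_correction_lim.
Qed.

(** * Dependence of the zeros on the order *)

Lemma BesselJ_pos_before_first_zero (nu x : R) : 0 <= nu -> 0 < x < bessel_zero nu 1 ->
  0 < BesselJ nu x.
Proof.
  intros Hnu Hx. destruct (BesselJ_pos_near_0 nu Hnu) as [d [Hd Hpos]].
  destruct (bessel_zero_next nu 0 Hnu) as [_ [_ Hno]].
  change (bessel_zero nu 0) with 0 in Hno.
  destruct (nonvanishing_sign (BesselJ nu) 0 (bessel_zero nu 1)) as [H | H]; auto.
  - intros t Ht. apply BesselJ_continuous; lra.
  - exfalso. set (t := Rmin (d / 2) x).
    assert (0 < t) by (apply Rmin_glb_lt; lra).
    assert (t <= d / 2) by apply Rmin_l. assert (t <= x) by apply Rmin_r.
    specialize (H t ltac:(lra)). specialize (Hpos t ltac:(lra)). lra.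
Qed.

(** Up to a positive factor the leading coefficient of the Wronskian at the origin
    is [mu - nu]. *)
Lemma BesselJ_wronskian_pos_near_0 (nu mu : R) : 0 <= nu < mu ->
  exists d, 0 < d /\ forall x, 0 < x < d ->
    0 < BesselJ nu x * BesselJ' mu x - BesselJ mu x * BesselJ' nu x.
Proof.
  intro Hnu. set (E := bessel_series).
  destruct (positive_near_0 (fun u => (mu - nu) * (E nu u * E mu u)
      - u * (2 * (E nu u * E (mu + 1) u - E mu u * E (nu + 1) u)))) as [d [Hd Hpos]].
  - assert (Hc : forall al be, 0 <= al -> 0 <= be -> continuous (fun u => E al u * E be u) 0).
    { intros al be Ha Hb. apply (continuous_mult (E al) (E be));
        now apply bessel_series_continuous. }
    apply (continuous_minus (fun u => (mu - nu) * (E nu u * E mu u))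
             (fun u => u * (2 * (E nu u * E (mu + 1) u - E mu u * E (nu + 1) u)))).
    + apply (continuous_scal_r (mu - nu) (fun u => E nu u * E mu u)), Hc; lra.
    + apply (continuous_mult (fun u => u)
        (fun u => 2 * (E nu u * E (mu + 1) u - E mu u * E (nu + 1) u))); [apply continuous_id |].
      apply (continuous_scal_r 2 (fun u => E nu u * E (mu + 1) u - E mu u * E (nu + 1) u)).
      apply (continuous_minus (fun u => E nu u * E (mu + 1) u) (fun u => E mu u * E (nu + 1) u));
        apply Hc; lra.
  - rewrite Rmult_0_l, Rminus_0_r.
    repeat apply Rmult_lt_0_compat; [lra | |]; apply bessel_series_0_pos; lra.
  - exists d. split; [exact Hd |]. intros x Hx. specialize (Hpos x Hx). unfold BesselJ'.
    rewrite !BesselJ_succ_series, !BesselJ_series by lra. fold E.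
    match goal with |- 0 < ?w => replace w with (Rpower (x / 2) nu * Rpower (x / 2) mu *
      ((mu - nu) * (E nu ((x / 2) ^ 2) * E mu ((x / 2) ^ 2)) - (x / 2) ^ 2 *
       (2 * (E nu ((x / 2) ^ 2) * E (mu + 1) ((x / 2) ^ 2)
             - E mu ((x / 2) ^ 2) * E (nu + 1) ((x / 2) ^ 2))))) by field end.
    apply Rmult_lt_0_compat; [apply Rmult_lt_0_compat; apply exp_pos | exact Hpos].
Qed.

(** Raising the order lowers the potential [x ^ 2 - nu ^ 2] and delays the zeros. *)
Lemma bessel_zero_monotone (nu mu : R) (k : nat) : 0 <= nu < mu ->
  bessel_zero nu k <= bessel_zero mu k.
Proof.
  intro Hnu. assert (Hnu0 : 0 <= nu) by lra. assert (Hmu0 : 0 <= mu) by lra.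
  induction k as [| k IH]; [apply Rle_refl |].
  destruct k as [| k].
  - apply Rnot_lt_le. intro Hlt. set (b := bessel_zero mu 1) in *.
    assert (Hb : 0 < b) by now apply bessel_zero_pos.
    destruct (BesselJ_wronskian_pos_near_0 nu mu Hnu) as [d [Hd Hw]].
    set (a := Rmin d b / 2).
    assert (Ha : 0 < a < b /\ a < d).
    { pose proof (Rmin_l d b). pose proof (Rmin_r d b). pose proof (Rmin_glb_lt d b 0 Hd Hb).
      unfold a. lra. }
    apply (sturm_wronskian _ _ _ _ _ _ 0 a b (Rle_refl 0) (BesselJ_solves nu Hnu0)
             (BesselJ_solves mu Hmu0)).
    + lra.
    + intros x Hx. nra.
    + intros x Hx. apply BesselJ_pos_before_first_zero; [exact Hmu0 | fold b; lra].
    + intros x Hx. apply BesselJ_pos_before_first_zero; lra.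
    + now apply bessel_zero_root.
    + apply Rlt_le, Hw. lra.
  - destruct (bessel_zero_next mu (S k) Hmu0) as [Hlt [_ Hno]].
    assert (Hp := bessel_zero_pos mu k Hmu0).
    destruct (sturm _ _ _ _ _ _ 0 (bessel_zero mu (S k)) (bessel_zero mu (S (S k)))
                (Rle_refl 0) (BesselJ_solves nu Hnu0) (BesselJ_solves mu Hmu0)) as [c [Hc H0]].
    + lra.
    + intros x Hx. nra.
    + now apply bessel_zero_root.
    + now apply bessel_zero_root.
    + exact Hno.
    + apply Rle_trans with c; [apply bessel_zero_le_root; auto; lra | lra].
Qed.

Lemma bessel_zero_lt_succ_order (nu : R) (k : nat) : 0 <= nu ->
  bessel_zero nu (S k) < bessel_zero (nu + 1) (S k).
Proof.
  intro Hnu. destruct (bessel_zero_monotone nu (nu + 1) (S k) ltac:(lra)) as [H | H]; [exact H |].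
  exfalso. apply (BesselJ_no_common_zero nu (bessel_zero nu (S k)) Hnu).
  - now apply bessel_zero_pos.
  - now apply bessel_zero_root.
  - rewrite H. apply bessel_zero_root. lra.
Qed.

(** Rolle's theorem for [x ^ (- nu) J_nu], whose derivative is [- x ^ (- nu) J_(nu + 1)]. *)
Lemma BesselJ_succ_zero_between (nu : R) (k : nat) : 0 <= nu ->
  exists x, bessel_zero nu (S k) < x < bessel_zero nu (S (S k)) /\ BesselJ (nu + 1) x = 0.
Proof.
  intro Hnu. assert (Hp := bessel_zero_pos nu k Hnu).
  destruct (mean_value (fun x => bessel_series nu ((x / 2) ^ 2))
    (fun x => - (x / 2) * bessel_series (nu + 1) ((x / 2) ^ 2))
    (bessel_zero nu (S k)) (bessel_zero nu (S (S k)))) as [x [Hx E]].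
  - now apply bessel_zero_lt_succ.
  - intros t Ht. now apply scaled_series_derive.
  - assert (Hz : forall m, bessel_series nu ((bessel_zero nu (S m) / 2) ^ 2) = 0).
    { intro m. pose proof (bessel_zero_root nu m Hnu) as H0.
      rewrite BesselJ_series in H0 by now apply bessel_zero_pos.
      apply Rmult_integral in H0. destruct H0 as [H0 | H0]; [| exact H0].
      pose proof (exp_pos (nu * ln (bessel_zero nu (S m) / 2))).
      unfold Rpower in H0. lra. }
    rewrite !Hz in E. exists x. split; [exact Hx |].
    rewrite BesselJ_series by lra.
    assert (Hz0 : bessel_series (nu + 1) ((x / 2) ^ 2) = 0); [| rewrite Hz0; ring].
    assert (E0 : (x / 2 * (bessel_zero nu (S (S k)) - bessel_zero nu (S k)))
                 * bessel_series (nu + 1) ((x / 2) ^ 2) = 0) by lra.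
    apply Rmult_integral in E0. destruct E0 as [E0 | E0]; [| exact E0].
    assert (0 < x / 2 * (bessel_zero nu (S (S k)) - bessel_zero nu (S k)))
      by (apply Rmult_lt_0_compat; lra). lra.
Qed.

Lemma bessel_zero_succ_order_lt (nu : R) (k : nat) : 0 <= nu ->
  bessel_zero (nu + 1) k < bessel_zero nu (S k).
Proof.
  intro Hnu. induction k as [| k IH]; [now apply bessel_zero_pos |].
  destruct (BesselJ_succ_zero_between nu k Hnu) as [x [Hx H0]].
  apply Rle_lt_trans with x; [| lra].
  apply bessel_zero_le_root; [lra | lra | exact H0].
Qed.

(** The angle [atan (f / g)] starts from [0] at [a], has speed at least [m], and
    cannot reach [PI / 2] while [g] does not vanish. *)
Lemma quarter_turn (f g df dg : R -> R) (a b m : R) : a < b ->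
  (forall x, a <= x < b -> is_derive f x (df x)) ->
  (forall x, a <= x < b -> is_derive g x (dg x)) ->
  (forall x, a <= x < b -> g x <> 0) ->
  (forall x, a <= x < b -> m * (f x ^ 2 + g x ^ 2) <= df x * g x - f x * dg x) ->
  f a = 0 -> m * (b - a) <= PI / 2.
Proof.
  intros Hab Hf Hg Hgn Hm Ha. pose proof PI_RGT_0.
  assert (Hall : forall x, a < x < b -> m * (x - a) < PI / 2).
  { intros x Hx.
    destruct (mean_value (fun t => atan (f t / g t))
      (fun t => (df t * g t - f t * dg t) / (f t ^ 2 + g t ^ 2)) a x) as [t [Ht E]].
    - lra.
    - intros t Ht. assert (Hgt := Hgn t ltac:(lra)).
      assert (0 < g t ^ 2) by (apply pow2_gt_0, Hgt). assert (0 <= f t ^ 2) by apply pow2_ge_0.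
      eapply is_derive_value.
      + apply (is_derive_compose atan (fun t => f t / g t)).
        * apply is_derive_Reals, derivable_pt_lim_atan.
        * apply (is_derive_div f g); [apply Hf; lra | apply Hg; lra | exact Hgt].
      + unfold Rsqr. field. repeat split; try exact Hgt; nra.
    - rewrite Ha, Rdiv_0_l, atan_0 in E.
      assert (Hgt := Hgn t ltac:(lra)). specialize (Hm t ltac:(lra)).
      assert (0 < g t ^ 2) by (apply pow2_gt_0, Hgt). assert (0 <= f t ^ 2) by apply pow2_ge_0.
      assert (Hq : m <= (df t * g t - f t * dg t) / (f t ^ 2 + g t ^ 2)).
      { apply Rmult_le_reg_r with (f t ^ 2 + g t ^ 2); [lra |].
        replace (_ / _ * _) with (df t * g t - f t * dg t) by (field; lra). exact Hm. }
      destruct (atan_bound (f x / g x)). nra. }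
  apply Rnot_lt_le. intro Hlt.
  assert (Hm0 : 0 < m).
  { apply Rnot_le_lt. intro Hle. assert (0 <= - m * (b - a)) by (apply Rmult_le_pos; lra). lra. }
  assert (Hx : a < a + PI / 2 / m < b).
  { split.
    - assert (0 < PI / 2 / m) by (apply Rdiv_lt_0_compat; lra). lra.
    - assert (PI / 2 / m < b - a); [| lra].
      apply Rmult_lt_reg_r with m; [exact Hm0 |].
      replace (PI / 2 / m * m) with (PI / 2) by (field; lra). lra. }
  specialize (Hall _ Hx). replace (m * (a + PI / 2 / m - a)) with (PI / 2) in Hall by (field; lra).
  lra.
Qed.

(** The left factor bounds below the angular speed of [(J_nu, J_(nu + 1))] beyond [a]. *)
Lemma BesselJ_rotation (nu a x : R) : 0 <= nu -> 0 < a <= x ->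
  (1 - (2 * nu + 1) / (2 * a)) * (BesselJ nu x ^ 2 + BesselJ (nu + 1) x ^ 2)
  <= BesselJ nu x ^ 2 + BesselJ (nu + 1) x ^ 2
     - (2 * nu + 1) / x * (BesselJ nu x * BesselJ (nu + 1) x).
Proof.
  intros Hnu Hx. set (u := BesselJ nu x). set (v := BesselJ (nu + 1) x).
  assert (Hk : (2 * nu + 1) / x <= (2 * nu + 1) / a).
  { apply Rmult_le_compat_l; [lra |]. apply Rinv_le_contravar; lra. }
  assert (Hk0 : 0 < (2 * nu + 1) / x) by (apply Rdiv_lt_0_compat; lra).
  replace ((2 * nu + 1) / (2 * a)) with ((2 * nu + 1) / a / 2) by (field; lra).
  set (K := (2 * nu + 1) / a) in *. set (k := (2 * nu + 1) / x) in *.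
  assert (2 * (u * v) <= u ^ 2 + v ^ 2) by (pose proof (pow2_ge_0 (u - v)); nra).
  assert (0 <= u ^ 2 + v ^ 2) by (pose proof (pow2_ge_0 u); pose proof (pow2_ge_0 v); lra).
  nra.
Qed.

Lemma bessel_zero_first_half_gap (nu : R) (k : nat) : 0 <= nu ->
  (1 - (2 * nu + 1) / (2 * bessel_zero nu (S k)))
  * (bessel_zero (nu + 1) (S k) - bessel_zero nu (S k)) <= PI / 2.
Proof.
  intro Hnu. assert (Hp := bessel_zero_pos nu k Hnu).
  apply (quarter_turn (fun x => - BesselJ nu x) (BesselJ (nu + 1))
    (fun x => - (nu / x * BesselJ nu x - BesselJ (nu + 1) x))
    (fun x => BesselJ nu x - (nu + 1) / x * BesselJ (nu + 1) x)).
  - now apply bessel_zero_lt_succ_order.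
  - intros x Hx. apply (is_derive_opp (BesselJ nu)), BesselJ_derive; lra.
  - intros x Hx. apply BesselJ_succ_derive; lra.
  - intros x Hx. destruct (bessel_zero_next (nu + 1) k ltac:(lra)) as [_ [_ Hno]].
    apply Hno. pose proof (bessel_zero_succ_order_lt nu k Hnu). lra.
  - intros x Hx. pose proof (BesselJ_rotation nu (bessel_zero nu (S k)) x Hnu ltac:(lra)) as H.
    replace ((- BesselJ nu x) ^ 2) with (BesselJ nu x ^ 2) by ring.
    eapply Rle_trans; [exact H |]. right. field. lra.
  - rewrite bessel_zero_root by exact Hnu. ring.
Qed.

Lemma bessel_zero_second_half_gap (nu : R) (k : nat) : 0 <= nu ->
  (1 - (2 * nu + 1) / (2 * bessel_zero (nu + 1) (S k)))
  * (bessel_zero nu (S (S k)) - bessel_zero (nu + 1) (S k)) <= PI / 2.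
Proof.
  intro Hnu. assert (Hp := bessel_zero_pos (nu + 1) k ltac:(lra)).
  apply (quarter_turn (BesselJ (nu + 1)) (BesselJ nu)
    (fun x => BesselJ nu x - (nu + 1) / x * BesselJ (nu + 1) x)
    (fun x => nu / x * BesselJ nu x - BesselJ (nu + 1) x)).
  - now apply bessel_zero_succ_order_lt.
  - intros x Hx. apply BesselJ_succ_derive; lra.
  - intros x Hx. apply BesselJ_derive; lra.
  - intros x Hx. destruct (bessel_zero_next nu (S k) Hnu) as [_ [_ Hno]].
    apply Hno. pose proof (bessel_zero_lt_succ_order nu k Hnu). lra.
  - intros x Hx. pose proof (BesselJ_rotation nu (bessel_zero (nu + 1) (S k)) x Hnu ltac:(lra)) as H.
    rewrite (Rplus_comm (_ ^ 2)). eapply Rle_trans; [exact H |]. right. field. lra.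
  - apply bessel_zero_root. lra.
Qed.

Lemma half_gap_limit (d z : nat -> R) (K l : R) :
  (forall k, (1 - K / (2 * z k)) * d k <= PI / 2) ->
  is_lim_seq z p_infty -> is_lim_seq d l -> l <= PI / 2.
Proof.
  intros Hle Hz Hd.
  apply (is_lim_seq_le (fun k => (1 - K / 2 * / z k) * d k) (fun _ => PI / 2) l (PI / 2)).
  - intro k. eapply Rle_trans; [| apply (Hle k)]. right. unfold Rdiv.
    rewrite Rinv_mult. ring.
  - replace (Finite l) with (Finite ((1 - K / 2 * 0) * l)) by (f_equal; ring).
    apply is_lim_seq_mult'; [| exact Hd].
    apply is_lim_seq_minus'; [apply is_lim_seq_const |].
    apply (is_lim_seq_scal_l (fun k => / z k) (K / 2) 0).
    apply (is_lim_seq_inv z p_infty Hz). discriminate.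
  - apply is_lim_seq_const.
Qed.

(** The two halves of a gap between zeros of [J_nu], cut at the zero of
    [J_(nu + 1)] that it contains, are asymptotically at most [PI / 2], while the
    whole gap tends to [PI]. *)
Lemma phase_constant_succ (nu c : R) : 0 <= nu -> phase_constant nu c -> phase_constant (nu + 1) c.
Proof.
  intros Hnu Hc. assert (Hnu1 : 0 <= nu + 1) by lra.
  destruct (phase_constant_exists (nu + 1) Hnu1) as [c' Hc'].
  assert (L := bessel_zero_asymptotic nu c Hnu Hc).
  assert (L' := bessel_zero_asymptotic (nu + 1) c' Hnu1 Hc').
  assert (H1 : (nu + 1) * PI / 2 + PI / 4 + c' - (nu * PI / 2 + PI / 4 + c) <= PI / 2).
  { apply (half_gap_limit (fun k => bessel_zero (nu + 1) (S k) - bessel_zero nu (S k))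
             (fun k => bessel_zero nu (S k)) (2 * nu + 1)).
    - intro k. now apply bessel_zero_first_half_gap.
    - now apply bessel_zero_lim.
    - eapply is_lim_seq_ext; [| apply (is_lim_seq_minus' _ _ _ _ L' L)]. intro k. simpl. ring. }
  assert (H2 : nu * PI / 2 + PI / 4 + c - ((nu + 1) * PI / 2 + PI / 4 + c') + PI <= PI / 2).
  { apply (half_gap_limit (fun k => bessel_zero nu (S (S k)) - bessel_zero (nu + 1) (S k))
             (fun k => bessel_zero (nu + 1) (S k)) (2 * nu + 1)).
    - intro k. now apply bessel_zero_second_half_gap.
    - now apply bessel_zero_lim.
    - apply is_lim_seq_incr_1 in L.
      eapply is_lim_seq_ext;
        [| apply (is_lim_seq_plus' _ _ _ _ (is_lim_seq_minus' _ _ _ _ L L') (is_lim_seq_const PI))].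
      intro k. cbv beta. rewrite (S_INR (S k)). ring. }
  replace c with c' by lra. exact Hc'.
Qed.

Lemma phase_constant_plus (nu c : R) (n : nat) : 0 <= nu -> phase_constant nu c ->
  phase_constant (nu + INR n) c.
Proof.
  intros Hnu Hc. induction n as [| n IH].
  - now rewrite Rplus_0_r.
  - rewrite S_INR, <- Rplus_assoc. apply phase_constant_succ; [| exact IH].
    pose proof (pos_INR n). lra.
Qed.

(** * The phase constant does not depend on the order *)

Lemma theta_tilde_derive_order (x t : R) : 0 <= t < x ->
  is_derive (fun t => theta_tilde t x) t (- acos (t / x)).
Proof.
  intro Ht. destruct (phase_speed_sqr t x Ht) as [Hr Hr2].
  assert (Hq := ratio_bounds t x Ht).
  unfold theta_tilde. eapply is_derive_value.
  - apply (is_derive_difference (fun t => sqrt (x ^ 2 - t ^ 2) - t * acos (t / x)) (fun _ => PI / 4));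
      [| apply (is_derive_const (PI / 4))].
    apply (is_derive_difference (fun t => sqrt (x ^ 2 - t ^ 2)) (fun t => t * acos (t / x))).
    + apply (is_derive_sqrt (fun t => x ^ 2 - t ^ 2)); [| nra].
      instantiate (1 := - 2 * t). auto_derive; [exact I | ring].
    + apply (is_derive_product (fun t => t) (fun t => acos (t / x))); [apply (is_derive_id t) |].
      apply (is_derive_compose acos (fun t => t / x)); [apply is_derive_acos; lra |].
      instantiate (1 := / x). auto_derive; [exact I | field; lra].
  - change zero with 0. change one with 1. rewrite sqrt_1_minus_ratio by exact Ht.
    cbv beta. fold (phase_speed t x). field. lra.
Qed.

Lemma acos_nonincreasing (s t : R) : 0 <= s -> s <= t -> t <= 1 -> acos t <= acos s.
Proof.
  intros Hs Hst Ht. apply Rnot_lt_le. intro Hlt.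
  destruct (acos_bound s). destruct (acos_bound t).
  pose proof (cos_decreasing_1 (acos s) (acos t) ltac:(lra) ltac:(lra) ltac:(lra) ltac:(lra) Hlt) as H3.
  rewrite !cos_acos in H3 by lra. lra.
Qed.

Lemma theta_tilde_order_difference (a b x : R) : 0 <= a < b -> b < x ->
  theta_tilde a x - theta_tilde b x <= (b - a) * acos (a / x).
Proof.
  intros Hab Hx.
  destruct (mean_value (fun t => theta_tilde t x) (fun t => - acos (t / x)) a b) as [t [Ht E]].
  - lra.
  - intros t Ht. apply theta_tilde_derive_order. lra.
  - assert (H : acos (t / x) <= acos (a / x)).
    { apply acos_nonincreasing.
      - apply ratio_bounds. lra.
      - apply Rmult_le_compat_r; [apply Rlt_le, Rinv_0_lt_compat |]; lra.
      - apply Rlt_le, ratio_bounds. lra. }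
    nra.
Qed.

(** Far enough above the turning point, on the scale of the order, the phase runs
    through [PI] within a distance small on that scale, so it meets a zero there. *)
Lemma bessel_zero_in_window (b eta : R) : 0 < eta -> 0 < b ->
  PI * (1 + 2 * eta) / eta ^ 2 < b ->
  exists k, (1 + eta) * b < bessel_zero b (S k) <= (1 + 2 * eta) * b.
Proof.
  intros Heta Hb Hlarge. pose proof PI_RGT_0.
  set (x0 := (1 + eta) * b). set (x1 := (1 + 2 * eta) * b).
  assert (Hx0 : 0 <= b < x0) by (unfold x0; split; nra).
  assert (Hx01 : x0 < x1) by (unfold x0, x1; nra).
  destruct (theta_tilde_attains b x0 (theta_tilde b x0 + PI) Hx0 ltac:(lra)) as [y [Hy Ey]].
  destruct (BesselJ_zero_in_gap b x0 y Hx0 Hy Ey) as [z [Hz Hz0]].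
  destruct (bessel_zero_all b z ltac:(lra) ltac:(lra) Hz0) as [k ->].
  exists k. split; [lra |]. apply Rle_trans with y; [lra |].
  apply Rnot_lt_le. intro Hlt.
  pose proof (theta_tilde_increasing b x1 y ltac:(lra) ltac:(lra)) as Hm.
  destruct (mean_value (theta_tilde b) (fun t => phase_speed b t / t) x0 x1 Hx01) as [t [Ht E]].
  { intros t Ht. apply theta_tilde_derive. lra. }
  destruct (phase_speed_ge b t ltac:(lra)) as [Hr _].
  assert (Hsp : eta / (1 + 2 * eta) <= phase_speed b t / t).
  { apply Rle_trans with (eta * b / x1).
    - right. unfold x1. field. lra.
    - apply Rmult_le_compat; try nra.
      + apply Rlt_le, Rinv_0_lt_compat. lra.
      + unfold x0 in Ht. lra.
      + apply Rinv_le_contravar; lra. }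
  assert (Hgain : PI < eta / (1 + 2 * eta) * (x1 - x0)).
  { replace (x1 - x0) with (eta * b) by (unfold x0, x1; ring).
    apply Rle_lt_trans with (eta / (1 + 2 * eta) * (eta * (PI * (1 + 2 * eta) / eta ^ 2))).
    - right. field. lra.
    - apply Rmult_lt_compat_l; [apply Rdiv_lt_0_compat; lra |].
      apply Rmult_lt_compat_l; lra. }
  assert (eta / (1 + 2 * eta) * (x1 - x0) <= phase_speed b t / t * (x1 - x0))
    by (apply Rmult_le_compat_r; lra).
  lra.
Qed.

Lemma theta_correction_window (b eta x : R) : 0 < eta -> 0 < b -> (1 + eta) * b < x ->
  theta_correction b x <= (/ (8 * eta) + 5 / (24 * eta ^ 3)) / b.
Proof.
  intros Heta Hb Hx. assert (Hbx : 0 <= b < x) by nra.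
  destruct (phase_speed_ge b x Hbx) as [Hr _]. unfold theta_correction.
  assert (Heb : 0 < eta * b) by nra.
  assert (Hle : eta * b <= phase_speed b x) by lra.
  assert (A : / (8 * phase_speed b x) <= / (8 * (eta * b))) by (apply Rinv_le_contravar; lra).
  assert (B : 5 * b ^ 2 / (24 * phase_speed b x ^ 3) <= 5 * b ^ 2 / (24 * (eta * b) ^ 3)).
  { apply Rmult_le_compat_l; [nra |]. assert (0 < (eta * b) ^ 3) by now apply pow_lt.
    apply Rinv_le_contravar; [lra |]. apply Rmult_le_compat_l; [lra |]. apply pow_incr. lra. }
  eapply Rle_trans; [apply (Rplus_le_compat _ _ _ _ A B) |]. right. field. lra.
Qed.

(** Both sandwiches are used at the zero of the higher order, which lies beyond the
    zero of the same index of the lower order. *)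
Lemma phase_constant_difference (a b c c' : R) (k : nat) : 0 <= a < b ->
  phase_constant a c -> phase_constant b c' ->
  c - c' <= (b - a) * acos (a / bessel_zero b (S k)) + theta_correction b (bessel_zero b (S k)).
Proof.
  intros Hab Hc Hc'. set (x := bessel_zero b (S k)).
  assert (Hx : b < x) by (apply bessel_zero_gt; lra).
  pose proof (theta_tilde_order_difference a b x Hab Hx) as H1.
  specialize (Hc k). specialize (Hc' k). fold x in Hc'.
  rewrite theta_under_correction in Hc' by lra.
  pose proof (bessel_zero_monotone a b (S k) Hab) as H2. fold x in H2.
  pose proof (theta_tilde_increasing a (bessel_zero a (S k)) x) as H3.
  specialize (H3 ltac:(split; [lra | apply bessel_zero_gt; lra]) H2). lra.
Qed.

Lemma INR_unbounded (M : R) : exists n, M < INR n.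
Proof.
  destruct (archimed (Rabs M)) as [H _]. exists (Z.to_nat (up (Rabs M))).
  rewrite INR_IZR_INZ, Z2Nat.id.
  - pose proof (Rle_abs M). lra.
  - apply le_IZR. pose proof (Rabs_pos M). lra.
Qed.

(** After a large common shift of both orders the zeros can be compared at a point
    just above both turning points, where the two comparison phases agree up to an
    arbitrarily small error. *)
Lemma phase_constant_monotone (nu mu c c' : R) : 0 <= nu < mu ->
  phase_constant nu c -> phase_constant mu c' -> c <= c'.
Proof.
  intros Hnu Hc Hc'. apply Rnot_lt_le. intro Hlt.
  set (e := c - c'). assert (He : 0 < e) by (unfold e; lra).
  set (d := mu - nu). assert (Hd : 0 < d) by (unfold d; lra).
  pose proof PI2_1 as HPI.
  (* The order difference [d] times this angle costs at most half of the gap [e]. *)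
  set (al := Rmin (e / (2 * d)) 1).
  assert (Hal : 0 < al <= 1).
  { split; [apply Rmin_glb_lt; [apply Rdiv_lt_0_compat |]; lra | apply Rmin_r]. }
  assert (Hde : d * al <= e / 2).
  { apply Rle_trans with (d * (e / (2 * d))); [| right; field; lra].
    apply Rmult_le_compat_l; [lra | apply Rmin_l]. }
  set (y0 := cos al).
  assert (Hy0 : 0 < y0 < 1).
  { split; [apply cos_gt_0; lra |]. unfold y0. rewrite <- cos_0. apply cos_decreasing_1; lra. }
  set (eta := (/ y0 - 1) / 4).
  assert (Hy1 : 1 < / y0) by (rewrite <- Rinv_1; apply Rinv_lt_contravar; lra).
  assert (Heta : 0 < eta) by (unfold eta; lra).
  set (K := / (8 * eta) + 5 / (24 * eta ^ 3)).
  assert (HK : 0 < K).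
  { assert (0 < eta ^ 3) by now apply pow_lt. unfold K.
    apply Rplus_lt_0_compat; [apply Rinv_0_lt_compat | apply Rdiv_lt_0_compat]; lra. }
  destruct (INR_unbounded (PI * (1 + 2 * eta) / eta ^ 2)) as [n1 Hn1].
  destruct (INR_unbounded (2 * K / e)) as [n2 Hn2].
  destruct (INR_unbounded (d * (1 + y0) / (1 - y0))) as [n3 Hn3].
  set (n := (S n1 + n2 + n3)%nat).
  assert (Hn : INR n = INR n1 + 1 + INR n2 + INR n3).
  { unfold n. rewrite !plus_INR, S_INR. reflexivity. }
  pose proof (pos_INR n1). pose proof (pos_INR n2). pose proof (pos_INR n3).
  set (a := nu + INR n). set (b := mu + INR n).
  assert (Hab : 0 <= a < b) by (unfold a, b; lra).
  destruct (bessel_zero_in_window b eta Heta ltac:(lra) ltac:(unfold b; lra)) as [k [Hk1 Hk2]].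
  pose proof (phase_constant_difference a b c c' k Hab
    (phase_constant_plus nu c n ltac:(lra) Hc) (phase_constant_plus mu c' n ltac:(lra) Hc')) as H2.
  set (x := bessel_zero b (S k)) in *.
  pose proof (theta_correction_window b eta x Heta ltac:(lra) Hk1) as H3. fold K in H3.
  assert (HKb : K / b < e / 2).
  { apply Rmult_lt_reg_r with b; [lra |]. replace (K / b * b) with K by (field; lra).
    replace K with (e / 2 * (2 * K / e)) by (field; lra).
    apply Rmult_lt_compat_l; [lra |]. unfold b. lra. }
  assert (Hacos : acos (a / x) <= al).
  { rewrite <- (acos_cos al) by lra. fold y0.
    apply acos_nonincreasing; [lra | | apply Rlt_le, ratio_bounds; nra].
    assert (Hx : 0 < x) by nra.
    apply Rmult_le_reg_r with x; [exact Hx |]. replace (a / x * x) with a by (field; lra).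
    apply Rle_trans with (y0 * ((1 + 2 * eta) * b)); [apply Rmult_le_compat_l; lra |].
    replace (y0 * ((1 + 2 * eta) * b)) with ((1 + y0) / 2 * b) by (unfold eta; field; lra).
    replace b with (a + d) by (unfold a, b, d; ring).
    assert (Ha : d * (1 + y0) < a * (1 - y0)).
    { replace (d * (1 + y0)) with (d * (1 + y0) / (1 - y0) * (1 - y0)) by (field; lra).
      apply Rmult_lt_compat_r; [lra | unfold a; lra]. }
    lra. }
  replace (b - a) with d in H2 by (unfold a, b, d; ring).
  assert (d * acos (a / x) <= d * al) by (apply Rmult_le_compat_l; lra).
  fold e in H2. lra.
Qed.

(** Shifting the second order by a large integer, which preserves its constant, makes
    it the larger one. *)
Lemma phase_constant_le (nu mu c c' : R) : 0 <= nu -> 0 <= mu ->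
  phase_constant nu c -> phase_constant mu c' -> c <= c'.
Proof.
  intros Hnu Hmu Hc Hc'. destruct (INR_unbounded nu) as [n Hn].
  apply (phase_constant_monotone nu (mu + INR n)).
  - lra.
  - exact Hc.
  - now apply phase_constant_plus.
Qed.

(** * The order one half *)

(** The phase [x] has potential [x ^ 2 - 1 / 4] exactly. *)
Lemma sine_solves : solves (fun x => x ^ 2 - (/ 2) ^ 2) (fun x => sin (x - 0) / sqrt x)
  (fun x => sqrt x * cos (x - 0) - x / (2 * x * sqrt x) * sin (x - 0)) 0.
Proof.
  assert (Hph : phase (fun x => x) (fun x => x) (fun x => x) (fun x => x) 0).
  { intros x Hx. split; [exact Hx |]. replace (x / x) with 1 by (field; lra).
    repeat split; apply (is_derive_id x). }
  intros x Hx. destruct (phase_solves _ _ _ _ 0 0 (Rle_refl 0) Hph x Hx) as [H1 H2].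
  split; [exact H1 |]. eapply is_derive_value; [exact H2 |].
  unfold phase_potential. assert (0 < sqrt x) by now apply sqrt_lt_R0. field. lra.
Qed.

(** The Wronskian of two solutions of one equation is constant; this one tends to
    [0] at the origin. *)
Lemma BesselJ_half_wronskian (x : R) : 0 < x ->
  BesselJ (/ 2) x * (sqrt x * cos (x - 0) - x / (2 * x * sqrt x) * sin (x - 0))
  - sin (x - 0) / sqrt x * BesselJ' (/ 2) x = 0.
Proof.
  intro Hx0.
  set (W := fun x => BesselJ (/ 2) x * (sqrt x * cos (x - 0) - x / (2 * x * sqrt x) * sin (x - 0))
    - sin (x - 0) / sqrt x * BesselJ' (/ 2) x).
  change (W x = 0).
  assert (Hconst : forall a b, 0 < a -> a < b -> W b = W a).
  { intros a b Ha Hab.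
    destruct (mean_value W (fun _ => 0) a b Hab) as [t [_ E]]; [| lra].
    intros t Ht. eapply is_derive_value.
    - apply (wronskian_derive _ _ _ _ _ _ 0 t (Rle_refl 0)
               (BesselJ_solves (/ 2) ltac:(lra)) sine_solves).
      lra.
    - cbv beta. rewrite Rminus_diag, Rmult_0_l. apply Rdiv_0_l. }
  set (E := fun nu x => bessel_series nu ((x / 2) ^ 2)).
  set (h := fun x => sqrt (/ 2) * ((x * cos x - sin x) * E (/ 2) x + x ^ 2 / 2 * sin x * E (/ 2 + 1) x)).
  assert (Hh : forall x, 0 < x -> W x = h x).
  { intros y Hy. unfold W, h, E, BesselJ'.
    rewrite BesselJ_succ_series, BesselJ_series, Rpower_sqrt, Rminus_0_r by lra.
    replace (sqrt (y / 2)) with (sqrt y * sqrt (/ 2)) by (symmetry; apply sqrt_mult; lra).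
    assert (Hs : 0 < sqrt y) by now apply sqrt_lt_R0.
    assert (Hss : y = sqrt y * sqrt y) by (symmetry; apply sqrt_sqrt; lra).
    generalize (bessel_series (/ 2) ((y / 2) ^ 2)), (bessel_series (/ 2 + 1) ((y / 2) ^ 2)),
      (cos y), (sin y), (sqrt (/ 2)).
    revert Hs Hss. generalize (sqrt y). intros s Hs ->. intros. field. lra. }
  assert (HE : forall nu, 0 <= nu -> continuous (E nu) 0).
  { intros nu Hnu. eapply derive_continuous. now apply scaled_series_derive. }
  assert (Hhc : continuous h 0).
  { apply (continuous_scal_r (sqrt (/ 2))
      (fun x => (x * cos x - sin x) * E (/ 2) x + x ^ 2 / 2 * sin x * E (/ 2 + 1) x)).
    apply (continuous_plus (fun x => (x * cos x - sin x) * E (/ 2) x)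
             (fun x => x ^ 2 / 2 * sin x * E (/ 2 + 1) x)).
    - apply (continuous_mult (fun x => x * cos x - sin x) (E (/ 2))); [| apply HE; lra].
      apply (ex_derive_continuous (fun x => x * cos x - sin x)). auto_derive. exact I.
    - apply (continuous_mult (fun x => x ^ 2 / 2 * sin x) (E (/ 2 + 1))); [| apply HE; lra].
      apply (ex_derive_continuous (fun x => x ^ 2 / 2 * sin x)). auto_derive. exact I. }
  apply NNPP. intro Hne.
  assert (Hsq : 0 < W x ^ 2) by now apply pow2_gt_0.
  destruct (continuous_pos_near (fun t => W x ^ 2 - h t * h t) 0) as [d [Hd Hnear]].
  - apply (continuous_minus (fun _ => W x ^ 2) (fun t => h t * h t)).
    + apply continuous_const.
    + now apply (continuous_mult h h).
  - replace (h 0) with 0; [lra |]. unfold h. rewrite sin_0. ring.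
  - set (t := Rmin (d / 2) (x / 2)).
    assert (0 < t) by (apply Rmin_glb_lt; lra).
    assert (t <= d / 2) by apply Rmin_l. assert (t <= x / 2) by apply Rmin_r.
    specialize (Hnear t ltac:(lra)). cbv beta in Hnear.
    rewrite <- Hh, <- (Hconst t x) in Hnear by lra. lra.
Qed.

Lemma BesselJ_half_zero_iff (x : R) : 0 < x -> (BesselJ (/ 2) x = 0 <-> sin x = 0).
Proof.
  intro Hx. pose proof (BesselJ_half_wronskian x Hx) as Hw. rewrite Rminus_0_r in Hw.
  assert (Hs : 0 < sqrt x) by now apply sqrt_lt_R0.
  split; intro H0; rewrite H0 in Hw.
  - assert (HJ : BesselJ' (/ 2) x <> 0).
    { unfold BesselJ'. rewrite H0. intro HJ.
      apply (BesselJ_no_common_zero (/ 2) x ltac:(lra) Hx H0).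
      apply Rmult_eq_reg_l with x; lra. }
    assert (Hp : sin x / sqrt x * BesselJ' (/ 2) x = 0) by lra.
    apply Rmult_integral in Hp. destruct Hp as [Hp | Hp]; [| contradiction].
    replace (sin x) with (sin x / sqrt x * sqrt x) by (field; lra). rewrite Hp. ring.
  - assert (Hp : BesselJ (/ 2) x * (sqrt x * cos x) = 0).
    { rewrite <- Hw. field. lra. }
    apply Rmult_integral in Hp. destruct Hp as [Hp | Hp]; [exact Hp |].
    apply Rmult_integral in Hp. destruct Hp as [Hp | Hp]; [lra |].
    exfalso. apply (cos_sin_0 x). now split.
Qed.

Lemma bessel_zero_half (k : nat) : bessel_zero (/ 2) k = INR k * PI.
Proof.
  pose proof PI_RGT_0. assert (Hnu : 0 <= / 2) by lra.
  induction k as [| k IH]; [simpl; unfold bessel_zero; simpl; ring |].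
  pose proof (pos_INR k).
  assert (Hle : bessel_zero (/ 2) (S k) <= INR (S k) * PI).
  { apply bessel_zero_le_root; [exact Hnu | rewrite IH, S_INR; lra |].
    apply BesselJ_half_zero_iff; [rewrite S_INR; nra |].
    apply sin_eq_0_1. exists (Z.of_nat (S k)). now rewrite INR_IZR_INZ. }
  assert (Hgt := bessel_zero_lt_succ (/ 2) k Hnu). rewrite IH in Hgt.
  assert (Hsin : sin (bessel_zero (/ 2) (S k)) = 0).
  { apply BesselJ_half_zero_iff; [now apply bessel_zero_pos | now apply bessel_zero_root]. }
  apply sin_eq_0_0 in Hsin. destruct Hsin as [m Hm]. rewrite Hm in Hle, Hgt |- *.
  rewrite INR_IZR_INZ in Hle, Hgt |- *.
  apply Rmult_lt_reg_r, lt_IZR in Hgt; [| assumption].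
  apply Rmult_le_reg_r, le_IZR in Hle; [| assumption].
  do 2 f_equal. lia.
Qed.

Lemma phase_constant_half : phase_constant (/ 2) (- (PI / 2)).
Proof.
  assert (Hnu : 0 <= / 2) by lra.
  destruct (phase_constant_exists (/ 2) Hnu) as [c Hc].
  assert (L := bessel_zero_asymptotic (/ 2) c Hnu Hc).
  assert (L0 : is_lim_seq (fun k => bessel_zero (/ 2) (S k) - PI * INR (S k)) 0).
  { apply (is_lim_seq_ext (fun _ => 0)); [| apply is_lim_seq_const].
    intro k. rewrite bessel_zero_half. ring. }
  apply is_lim_seq_unique in L. apply is_lim_seq_unique in L0. rewrite L0 in L.
  injection L as L. replace (- (PI / 2)) with c by lra. exact Hc.
Qed.

Lemma phase_constant_value (nu : R) : 0 <= nu -> phase_constant nu (- (PI / 2)).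
Proof.
  intro Hnu. destruct (phase_constant_exists nu Hnu) as [c Hc].
  assert (Hh : 0 <= / 2) by lra.
  pose proof (phase_constant_le nu (/ 2) c _ Hnu Hh Hc phase_constant_half).
  pose proof (phase_constant_le (/ 2) nu _ c Hh Hnu phase_constant_half Hc).
  replace (- (PI / 2)) with c by lra. exact Hc.
Qed.

(** * Counting *)

Lemma has_card_unique {T : Type} (P : T -> Prop) (m n : nat) :
  has_card P m -> has_card P n -> m = n.
Proof.
  intros [l [Hl [HlP <-]]] [l' [Hl' [HlP' <-]]].
  apply Nat.le_antisymm; apply NoDup_incl_length; auto; intros x Hx.
  - apply HlP', HlP, Hx.
  - apply HlP, HlP', Hx.
Qed.

Lemma bessel_zero_injective (nu : R) (m n : nat) : 0 <= nu ->
  bessel_zero nu m = bessel_zero nu n -> m = n.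
Proof.
  intros Hnu E. destruct (Nat.lt_trichotomy m n) as [H | [H | H]]; [| exact H |].
  - pose proof (bessel_zero_increasing nu m n Hnu H). lra.
  - pose proof (bessel_zero_increasing nu n m Hnu H). lra.
Qed.

Lemma bessel_zero_le_index (nu : R) (m n : nat) : 0 <= nu ->
  bessel_zero nu m <= bessel_zero nu n -> (m <= n)%nat.
Proof.
  intros Hnu Hle. apply Nat.nlt_ge. intro H.
  pose proof (bessel_zero_increasing nu n m Hnu H). lra.
Qed.

Lemma has_card_zeros_le (nu : R) (k : nat) : 0 <= nu ->
  has_card (fun y => 0 < y <= bessel_zero nu k /\ BesselJ nu y = 0) k.
Proof.
  intro Hnu. exists (map (bessel_zero nu) (seq 1 k)). split; [| split].
  - apply Injective_map_NoDup; [| apply seq_NoDup].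
    intros m n. now apply bessel_zero_injective.
  - intro x. rewrite in_map_iff. split.
    + intros [m [<- Hm]]. apply in_seq in Hm. destruct m as [| m]; [lia |].
      split; [split | now apply bessel_zero_root].
      * now apply bessel_zero_pos.
      * destruct (Nat.eq_dec (S m) k) as [-> | Hne]; [lra |].
        apply Rlt_le, bessel_zero_increasing; [exact Hnu | lia].
    + intros [[Hx Hle] H0]. destruct (bessel_zero_all nu x Hnu Hx H0) as [m ->].
      exists (S m). split; [reflexivity |]. apply in_seq.
      apply bessel_zero_le_index in Hle; [lia | exact Hnu].
  - now rewrite length_map, length_seq.
Qed.

Lemma is_bessel_zero_iff (nu x : R) (k : nat) : 0 <= nu ->
  (is_bessel_zero nu k x <-> (1 <= k)%nat /\ x = bessel_zero nu k).
Proof.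
  intro Hnu. split.
  - intros [Hx [H0 Hcard]]. destruct (bessel_zero_all nu x Hnu Hx H0) as [m ->].
    rewrite (has_card_unique _ _ _ Hcard (has_card_zeros_le nu (S m) Hnu)).
    split; [lia | reflexivity].
  - intros [Hk ->]. destruct k as [| k]; [lia |].
    split; [now apply bessel_zero_pos | split; [now apply bessel_zero_root |]].
    now apply has_card_zeros_le.
Qed.

Lemma counting_index (nu x : R) : 0 <= nu -> 0 < x ->
  exists N, bessel_zero nu N <= x < bessel_zero nu (S N).
Proof.
  intros Hnu Hx.
  destruct (bessel_zero_lim nu Hnu (fun y => x < y)) as [M HM]; [exists x; auto |].
  specialize (HM M (Nat.le_refl M)). simpl in HM. revert HM. generalize M.
  intro m. induction m as [| m IH]; intro Hlt.
  - exists 0%nat. split; [unfold bessel_zero; simpl; lra | exact Hlt].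
  - destruct (Rlt_le_dec x (bessel_zero nu (S m))) as [H | H]; [now apply IH |].
    exists (S m). now split.
Qed.

Lemma bessel_count_index (nu x : R) (N : nat) : 0 <= nu ->
  bessel_zero nu N <= x < bessel_zero nu (S N) -> is_bessel_count nu x N.
Proof.
  intros Hnu HN. exists (seq 1 N). split; [apply seq_NoDup | split; [| apply length_seq]].
  intro k. rewrite in_seq. split.
  - intro Hk. exists (bessel_zero nu k). split.
    + apply is_bessel_zero_iff; [exact Hnu | split; [lia | reflexivity]].
    + apply Rle_trans with (bessel_zero nu N); [| lra].
      destruct (Nat.eq_dec k N) as [-> | Hne]; [lra |].
      apply Rlt_le, bessel_zero_increasing; [exact Hnu | lia].
  - intros [y [Hy Hle]]. apply is_bessel_zero_iff in Hy; [| exact Hnu]. destruct Hy as [Hk ->].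
    split; [exact Hk |]. apply Nat.nle_gt. intro Hgt.
    pose proof (bessel_zero_increasing nu (S N) k Hnu) as Hinc.
    destruct (Nat.eq_dec k (S N)) as [-> | Hne]; [lra |]. specialize (Hinc ltac:(lia)). lra.
Qed.

(** With [al = acos (nu / x)] this is [al cos al <= sin al]; it makes the upper floor
    nonnegative when no zero has been passed. *)
Lemma theta_tilde_lower_bound (nu x : R) : 0 <= nu < x -> - (PI / 4) <= theta_tilde nu x.
Proof.
  intro Hx. assert (Hq := ratio_bounds nu x Hx).
  unfold theta_tilde. fold (phase_speed nu x).
  assert (Hr : phase_speed nu x = x * sin (acos (nu / x))).
  { rewrite sin_acos, sqrt_1_minus_ratio by lra. field. lra. }
  assert (Hn : nu = x * cos (acos (nu / x))) by (rewrite cos_acos by lra; field; lra).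
  destruct (acos_bound (nu / x)) as [H0 H1]. set (al := acos (nu / x)) in *.
  assert (Hg : 0 <= sin al - al * cos al).
  { replace 0 with (sin 0 - 0 * cos 0) by (rewrite sin_0; ring).
    apply (increasing_of_derive (fun t => sin t - t * cos t) (fun t => t * sin t)); [exact H0 | |].
    - intros t _. auto_derive; [exact I | ring].
    - intros t Ht. apply Rmult_le_pos; [lra | apply sin_ge_0; lra]. }
  rewrite Hr. assert (nu * al <= x * sin al); [| lra].
  rewrite Hn at 1. rewrite Rmult_assoc. apply Rmult_le_compat_l; lra.
Qed.

Theorem corollary1p7 :
  forall nu lambda : R, 0 <= nu -> nu < lambda ->
  exists N : nat,
    is_bessel_count nu lambda N /\
    (Zfloor (/ PI * Rmax (theta_under nu lambda) (- (PI / 2)) + / 2)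
       <= Z.of_nat N
       <= Zfloor (/ PI * theta_tilde nu lambda + / 2))%Z.
Proof.
  intros nu lambda Hnu Hlt. pose proof PI_RGT_0 as HPI.
  destruct (counting_index nu lambda Hnu ltac:(lra)) as [N HN].
  exists N. split; [now apply bessel_count_index |].
  assert (Hph := phase_constant_value nu Hnu).
  split.
  - (* The zero of index [N + 1] lies beyond [lambda]. *)
    apply Z.lt_succ_r, lt_IZR.
    eapply Rle_lt_trans; [apply Zfloor_bound |].
    rewrite succ_IZR, <- INR_IZR_INZ.
    assert (Hmax : Rmax (theta_under nu lambda) (- (PI / 2)) < PI * (INR N + / 2)).
    { pose proof (pos_INR N). apply Rmax_lub_lt; [| nra].
      apply Rlt_le_trans with (theta_under nu (bessel_zero nu (S N))).
      - apply theta_under_increasing; lra.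
      - destruct (Hph N) as [H1 _]. rewrite S_INR in H1. lra. }
    apply Rmult_lt_reg_l with PI; [exact HPI |].
    replace (PI * (/ PI * Rmax (theta_under nu lambda) (- (PI / 2)) + / 2))
      with (Rmax (theta_under nu lambda) (- (PI / 2)) + PI / 2) by (field; lra).
    lra.
  - apply Zfloor_lub. rewrite <- INR_IZR_INZ.
    assert (Ht : PI * (INR N - / 2) <= theta_tilde nu lambda).
    { destruct N as [| N].
      - pose proof (theta_tilde_lower_bound nu lambda (conj Hnu Hlt)). simpl. lra.
      - apply Rle_trans with (theta_tilde nu (bessel_zero nu (S N))).
        + destruct (Hph N) as [_ H2]. lra.
        + apply theta_tilde_increasing; [split; [exact Hnu | now apply bessel_zero_gt] | lra]. }
    apply Rmult_le_reg_l with PI; [exact HPI |].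
    replace (PI * (/ PI * theta_tilde nu lambda + / 2))
      with (theta_tilde nu lambda + PI / 2) by (field; lra).
    lra.
Qed.
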